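(* Let $(\mathcal{X},d)$ be Polish. Let $\pi\in\Pi(\mu,\nu)$ and $\tilde\pi\in\Pi(\tilde\mu,\tilde\nu)$ be Borel probability measures on $\mathcal{X}^2$ whose marginals all have finite first moments. Then $$\left|\int\mathcal{W}(\pi_{x_1},\nu)\,\mu(dx_1)-\int\mathcal{W}(\tilde\pi_{y_1},\tilde\nu)\,\tilde\mu(dy_1)\right|\le\mathcal{AW}(\pi,\tilde\pi)+\mathcal{W}(\nu,\tilde\nu)\le2\,\mathcal{AW}(\pi,\tilde\pi).$$ If moreover $\nu$ and $\tilde\nu$ are not Dirac measures, then $$\left|\overrightarrow{\mathcal{W}}(\pi)-\overrightarrow{\mathcal{W}}(\tilde\pi)\right|\le\frac{\mathcal{AW}(\pi,\tilde\pi)+\mathcal{W}(\nu,\tilde\nu)+g(\nu,\tilde\nu)}{f(\tilde\nu)}\le\frac{\mathcal{AW}(\pi,\tilde\pi)+3\mathcal{W}(\nu,\tilde\nu)}{f(\tilde\nu)}\le\frac{4\,\mathcal{AW}(\pi,\tilde\pi)}{f(\tilde\nu)},$$ where $f(\tilde\nu)=\int\int d(y,z)\,\tilde\nu(dy)\tilde\nu(dz)$ and $g(\nu,\tilde\nu)=\left|\int\int d(y,z)\,\tilde\nu(dy)\tilde\nu(dz)-\int\int d(y,z)\,\nu(dy)\nu(dz)\right|$.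
   Context: $\Pi(\alpha,\beta)$ denotes couplings of $\alpha,\beta$; $\pi_{x_1}$ (resp. $\tilde\pi_{y_1}$) is the disintegration of $\pi$ (resp. $\tilde\pi$) w.r.t. the first coordinate. $\mathcal{W}(\alpha,\beta)=\inf_{\gamma\in\Pi(\alpha,\beta)}\int d(x,y)\,\gamma(dx,dy)$. The adapted Wasserstein distance between Borel probability measures $\pi,\tilde\pi$ on $\mathcal{X}^2$ with first marginals $\pi_1,\tilde\pi_1$ is $$\mathcal{AW}(\pi,\tilde\pi)=\inf_{\gamma\in\Pi(\pi_1,\tilde\pi_1)}\int\big[d(x_1,y_1)+\mathcal{W}(\pi_{x_1},\tilde\pi_{y_1})\big]\,\gamma(dx_1,dy_1).$$ The Wasserstein correlation coefficient of $\pi\in\Pi(\mu,\nu)$ is $\overrightarrow{\mathcal{W}}(\pi)=\int\mathcal{W}(\pi_{x_1},\nu)\,\mu(dx_1)\big/\int\int d(y,z)\,\nu(dy)\nu(dz)$. *)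

(* Defs.v *)
From HB Require Import structures.
From mathcomp Require Import all_boot all_order all_algebra.
From mathcomp Require Import all_classical all_reals all_analysis.
From mathcomp Require Import measurable_realfun.
Set Implicit Arguments. Unset Strict Implicit. Unset Printing Implicit Defensive.
Import Order.TTheory GRing.Theory Num.Theory.
Local Open Scope classical_set_scope.
Local Open Scope ring_scope.

Section Polish.
Context {R : realType} {T : Type} (dist : T -> T -> R).

Definition is_metric : Prop :=
  [/\ forall x y, 0 <= dist x y,
      forall x y, dist x y = 0 <-> x = y,
      forall x y, dist x y = dist y x &
      forall x y z, dist x z <= dist x y + dist y z].

Definition dist_open (A : set T) : Prop :=
  forall x, A x -> exists2 e : R, 0 < e & forall y, dist x y < e -> A y.

Definition dist_separable : Prop :=
  exists s : nat -> T, forall x (e : R), 0 < e -> exists n, dist x (s n) < e.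

Definition dist_cauchy (u : nat -> T) : Prop :=
  forall e : R, 0 < e -> exists N, forall m n, (N <= m)%N -> (N <= n)%N ->
    dist (u m) (u n) < e.

Definition dist_complete : Prop :=
  forall u : nat -> T, dist_cauchy u ->
    exists l, forall e : R, 0 < e -> exists N, forall n, (N <= n)%N -> dist (u n) l < e.

Definition polish : Prop := [/\ is_metric, dist_separable & dist_complete].
End Polish.

Section Wasserstein.
Context {R : realType} {d : measure_display} {T : measurableType d}
  (dist : T -> T -> R).
Local Open Scope ereal_scope.

Definition borel_of_dist : Prop :=
  (@measurable d T) = <<s dist_open dist >>.

Definition coupling (alpha beta : probability T R)
  (gamma : probability (T * T)%type R) : Prop :=
  forall A, measurable A ->
    gamma (A `*` setT) = alpha A /\ gamma (setT `*` A) = beta A.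

Definition first_moment_finite (alpha : probability T R) : Prop :=
  exists x0 : T, \int[alpha]_x (dist x0 x)%:E < +oo.

Definition Wass (alpha beta : probability T R) : \bar R :=
  ereal_inf [set \int[gamma]_z (dist z.1 z.2)%:E
            | gamma in [set g | coupling alpha beta g]].

Definition disintegration (pi : probability (T * T)%type R)
  (mu : probability T R) (k : T -> probability T R) : Prop :=
  (forall B, measurable B -> measurable_fun [set: T] (fun x : T => k x B)) /\
  (forall A B, measurable A -> measurable B ->
     pi (A `*` B) = \int[mu]_(x in A) k x B).

(* AW(pi, pit), with k, kt the disintegrations of pi, pit and mu, mut
   their first marginals *)
Definition AW (mu mut : probability T R) (k kt : T -> probability T R) : \bar R :=
  ereal_inf [set \int[gamma]_z ((dist z.1 z.2)%:E + Wass (k z.1) (kt z.2))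
            | gamma in [set g | coupling mu mut g]].

Definition mean_dist (nu : probability T R) : \bar R :=
  \int[nu]_y \int[nu]_z (dist y z)%:E.

Definition Wint (mu nu : probability T R) (k : T -> probability T R) : \bar R :=
  \int[mu]_x Wass (k x) nu.

(* Wasserstein correlation coefficient (real-valued; both integrals are
   finite under the finite-first-moment hypotheses) *)
Definition Wcorr (mu nu : probability T R) (k : T -> probability T R) : R :=
  (fine (Wint mu nu k) / fine (mean_dist nu))%R.

Definition is_dirac (nu : probability T R) : Prop :=
  exists a : T, forall A, measurable A -> nu A = \d_a A.
End Wasserstein.

(* Main.v *)
(** Kantorovich duality, for the countable family of finite minima of cones
    [r + dist (s i) x] ([s] dense, [r] rational), turns the Wasserstein distance
    into a countable supremum of differences of integrals.  Hence it depends
    measurably on kernels, satisfies the triangle inequality, and is jointly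
    convex, so that W(nu, nut) <= \int W(pi_x, pit_y) dgamma for every coupling
    gamma of the first marginals: neither gluing nor measurable selection of
    optimal couplings is needed.

    For the duality itself, both measures are quantized to finitely many cells,
    the first moments controlling the unbounded cell.  Duality of the finite
    transport problem is a finite-dimensional Hahn-Banach argument, and its
    optimal plan, spread over each product of cells proportionally to the product
    measure, is a coupling of the original measures; no compactness is used. *)
Require Import Defs.
From HB Require Import structures.
From mathcomp Require Import all_boot all_order all_algebra.
From mathcomp Require Import all_classical all_reals all_analysis.
From mathcomp Require Import measurable_realfun.
From mathcomp Require Import giry lra ring.
Import Order.TTheory GRing.Theory Num.Theory.
Local Open Scope classical_set_scope.
Local Open Scope ring_scope.

(** * Finite Kantorovich duality *)

Section Sublinear.
Context {R : realType} {V : lmodType R}.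
Implicit Types (P Q : V -> R) (u v : V).

Definition sublinear P :=
  (forall u v, P (u + v) <= P u + P v) /\
  (forall r u, 0 < r -> P (r *: u) <= r * P u).

(** The converse inequality is the assumed one for [r^-1] at [r *: u]. *)
Lemma sublinearZ P r u : sublinear P -> 0 < r -> P (r *: u) = r * P u.
Proof.
move=> [_ PZ] r0; apply/eqP; rewrite eq_le PZ//=.
have := PZ r^-1 (r *: u); rewrite invr_gt0 => /(_ r0).
by rewrite scalerA mulVf ?gt_eqF// scale1r ler_pdivlMl.
Qed.

Lemma sublinear0 P : sublinear P -> P 0 = 0.
Proof.
by move=> sP; have := sublinearZ P 2 0 sP; rewrite scaler0 => /(_ (ltr0n _ 2)); lra.
Qed.

Lemma sublinear_opp P u : sublinear P -> 0 <= P u + P (- u).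
Proof. by move=> sP; have := sP.1 u (- u); rewrite subrr sublinear0. Qed.

(* The infimum over rays [u + s v], s >= 0, makes a sublinear functional odd at [v]
   without changing its value there. *)
Lemma sublinear_odd_at P v : sublinear P ->
  exists Q, [/\ sublinear Q, forall u, Q u <= P u & Q (- v) = - P v].
Proof.
move=> sP; pose S u := [set P (u + s *: v) - s * P v | s in [set s : R | 0 <= s]].
(* Subadditivity bounds the ray values from below: [s * P v = P (s *: v) <= P (u + s *: v) + P (-
   u)]. *)
have lbS u : lbound (S u) (- P (- u)).
  move=> _ [s /= s0 <-].
  have : P (s *: v) = s * P v.
    move: s0; rewrite le_eqVlt => /orP[/eqP<-|s0]; last exact: sublinearZ.
    by rewrite scale0r mul0r sublinear0.
  have := sP.1 (u + s *: v) (- u); rewrite (addrC u) addrK => ? ?; lra.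
have S0 u : S u !=set0 by exists (P (u + 0 *: v) - 0 * P v), 0 => /=.
have iS u : has_inf (S u) by split => //; exists (- P (- u)).
have infle u s : 0 <= s -> inf (S u) <= P (u + s *: v) - s * P v.
  by move=> s0; apply: (ge_inf (iS u).2); exists s.
exists (fun u => inf (S u)); split => [|u|].
(* Rays add up: parameters [s] for [u] and [t] for [w] give [s + t] for [u + w]; scaling by [r]
   turns [s] into [r * s]. *)
- split=> [u w|r u r0].
    rewrite -lerBlDr; apply: lb_le_inf => // _ [s /= s0 <-].
    rewrite lerBlDr -lerBlDl; apply: lb_le_inf => // _ [t /= t0 <-].
    have := infle (u + w) (s + t) (addr_ge0 s0 t0).
    have := sP.1 (u + s *: v) (w + t *: v).
    rewrite addrACA -scalerDl; lra.
  rewrite -ler_pdivrMl//; apply: lb_le_inf => // _ [s /= s0 <-].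
  rewrite ler_pdivrMl//; have := infle (r *: u) (r * s) (mulr_ge0 (ltW r0) s0).
  by rewrite -scalerA -scalerDr sublinearZ// -mulrA -mulrBr.
- by have := infle u 0 (lexx 0); rewrite scale0r addr0 mul0r subr0.
- apply/eqP; rewrite eq_le; apply/andP; split.
    have := infle (- v) 1 ler01.
    by rewrite scale1r addNr sublinear0// mul1r sub0r.
  by apply: lb_le_inf => //; have := lbS (- v); rewrite opprK.
Qed.

Definition odd_at P u := P (- u) = - P u.

(** Oddness survives passing to a smaller sublinear functional, because of the squeeze [Q u <= P u =
    - P (- u) <= - Q (- u) <= Q u]. *)
Lemma odd_at_mono P Q u : sublinear Q -> (forall w, Q w <= P w) ->
  odd_at P u -> odd_at Q u /\ Q u = P u.
Proof.
rewrite /odd_at => sQ QP Pu; have := sublinear_opp Q u sQ.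
have := QP u; have := QP (- u); rewrite Pu => ? ? ?; split; lra.
Qed.

(** The vectors are treated one after the other; by [odd_at_mono] later steps keep the oddness
    already obtained. On a basis this yields a linear minorant. *)
Lemma sublinear_odd_seq P (s : seq V) : sublinear P ->
  exists Q, [/\ sublinear Q, forall u, Q u <= P u & forall u, u \in s -> odd_at Q u].
Proof.
elim: s P => [|v s IH] P sP; first by exists P; split.
have [P' [sP' P'P P'v]] := sublinear_odd_at P v sP.
have [Q [sQ QP' Qs]] := IH P' sP'.
exists Q; split => // [u|u]; first exact: le_trans (QP' u) (P'P u).
rewrite inE => /orP[/eqP->|/Qs//].
have /(odd_at_mono P' Q v sQ QP')[]// : odd_at P' v.
by have := sublinear_opp P' v sP'; have := P'P v; rewrite /odd_at P'v; lra.
Qed.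

Lemma odd_atN P u : odd_at P u -> odd_at P (- u).
Proof. by rewrite /odd_at opprK => ->; rewrite opprK. Qed.

(** Equality is forced by [P (u + v) <= P u + P v], [P (- u - v) <= - P u - P v] and
    [0 <= P (u + v) + P (- u - v)]. *)
Lemma odd_atD P u v : sublinear P -> odd_at P u -> odd_at P v ->
  odd_at P (u + v) /\ P (u + v) = P u + P v.
Proof.
rewrite /odd_at => sP Pu Pv; have := sP.1 u v; have := sP.1 (- u) (- v).
have := sublinear_opp P (u + v) sP; rewrite opprD Pu Pv => ? ? ?; split; lra.
Qed.

Lemma odd_atZ P r u : sublinear P -> odd_at P u ->
  odd_at P (r *: u) /\ P (r *: u) = r * P u.
Proof.
rewrite /odd_at => sP Pu; have [r0|r0|->] := ltgtP r 0; last first.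
- by rewrite scale0r oppr0 mul0r sublinear0// oppr0.
- by rewrite -scalerN !(sublinearZ _ r)// Pu mulrN.
- have nr : 0 < - r by rewrite oppr_gt0.
  have -> : r *: u = (- r) *: (- u) by rewrite scalerN scaleNr opprK.
  rewrite -scalerN opprK !(sublinearZ _ (- r))// Pu; split; lra.
Qed.

Lemma odd_at_sum P (I : finType) (x : I -> R) (v : I -> V) : sublinear P ->
  (forall i, odd_at P (v i)) ->
  odd_at P (\sum_i x i *: v i) /\ P (\sum_i x i *: v i) = \sum_i x i * P (v i).
Proof.
move=> sP Pv.
apply: (big_ind2 (fun u r => odd_at P u /\ P u = r)).
- by rewrite /odd_at oppr0 sublinear0// oppr0.
- by move=> u _ w _ [Pu <-] [Pw <-]; exact: odd_atD.
- by move=> i _; exact: odd_atZ.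
Qed.

End Sublinear.

(** * Duality for the finite transport problem *)

Section FiniteKantorovich.
Context {R : realType} {n : nat}.
Variables (a b : 'I_n -> R) (c : 'I_n -> 'I_n -> R).
Hypotheses (a0 : forall i, 0 <= a i) (b0 : forall i, 0 <= b i).
Hypotheses (a1 : \sum_i a i = 1) (b1 : \sum_i b i = 1).

Let val (p : ('I_n -> R) * ('I_n -> R)) := \sum_i a i * p.1 i + \sum_i b i * p.2 i.
Let dom (h : 'M[R]_n) : set (('I_n -> R) * ('I_n -> R)) :=
  [set p | forall i j, h i j <= p.1 i + p.2 j].

(** The dual problem with reversed sign: [- dualval (- c)] is the supremum over potentials
    [phi i + psi j <= c i j]. In this form it is sublinear in the cost. *)
Let dualval (h : 'M[R]_n) := inf [set val p | p in dom h].

(** Testing against the product plan [a i * b j] bounds the dual values from below, so that the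
    infimum is a genuine one. *)
Let val_lb h p : dom h p -> \sum_i \sum_j (a i * b j) * h i j <= val p.
Proof.
move=> hp.
have -> : val p = \sum_i \sum_j (a i * b j) * (p.1 i + p.2 j).
  rewrite /val.
  under [RHS]eq_bigr do under eq_bigr do rewrite mulrDr.
  under [RHS]eq_bigr do rewrite big_split/=.
  rewrite big_split/=; congr (_ + _).
    apply: eq_bigr => i _; rewrite -(mulr1 (a i * _)) -b1 mulr_sumr.
    by apply: eq_bigr => j _; rewrite mulrAC.
  rewrite exchange_big/=; apply: eq_bigr => j _.
  rewrite -(mulr1 (b j * _)) -a1 mulr_sumr.
  by apply: eq_bigr => i _; rewrite mulrC mulrA.
by do 2!(apply: ler_sum => ? _); rewrite ler_wpM2l// mulr_ge0.
Qed.

Let dom0 h : [set val p | p in dom h] !=set0.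
Proof.
exists (val (fun i => \sum_j `|h i j|, fun=> 0)); exists (fun i => \sum_j `|h i j|, fun=> 0) => //.
move=> i j /=; rewrite addr0 (bigD1 j)//=.
by rewrite (le_trans (ler_norm _))// lerDl sumr_ge0.
Qed.

Let dom_inf h : has_inf [set val p | p in dom h].
Proof.
split; first exact: dom0.
by exists (\sum_i \sum_j (a i * b j) * h i j) => _ [p hp <-]; exact: val_lb.
Qed.

Let dualval_le h p : dom h p -> dualval h <= val p.
Proof. by move=> hp; apply: (ge_inf (dom_inf h).2); exists p. Qed.

Let valD p q : val (fun i => p.1 i + q.1 i, fun i => p.2 i + q.2 i) = val p + val q.
Proof.
rewrite /val/= addrACA; congr (_ + _);
  by rewrite -big_split/=; apply: eq_bigr => i _; rewrite mulrDr.
Qed.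

Let valZ r p : val (fun i => r * p.1 i, fun i => r * p.2 i) = r * val p.
Proof.
by rewrite /val/= mulrDr !mulr_sumr; congr (_ + _);
  apply: eq_bigr => i _; rewrite mulrCA.
Qed.

Let dualval_sublinear : sublinear dualval.
Proof.
split=> [u v|r u r0].
  rewrite -lerBlDr; apply: lb_le_inf => // _ [p /= up <-].
  rewrite lerBlDr -lerBlDl; apply: lb_le_inf => // _ [q /= vq <-].
  rewrite lerBlDl -valD; apply: dualval_le => i j /=; rewrite mxE.
  by rewrite addrACA lerD.
rewrite -ler_pdivrMl//; apply: lb_le_inf => // _ [p /= up <-].
rewrite ler_pdivrMl// -valZ; apply: dualval_le => i j /=; rewrite mxE.
by rewrite -mulrDr ler_pM2l.
Qed.

(** A linear functional below [dualval] and equal to it at [- c] is an optimal plan, read off on the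
    matrix units. The slack [e] is there because the potentials are only nearly optimal. *)
Lemma finite_kantorovich (e : R) : 0 < e ->
  exists p : 'I_n -> 'I_n -> R, exists phi psi : 'I_n -> R,
  [/\ forall i j, 0 <= p i j,
      forall i, \sum_j p i j = a i,
      forall j, \sum_i p i j = b j,
      forall i j, phi i + psi j <= c i j &
      \sum_i \sum_j p i j * c i j <= \sum_i a i * phi i + \sum_i b i * psi i + e].
Proof.
move=> e0; pose C : 'M[R]_n := \matrix_(i, j) c i j.
(* Oddness at [- C] comes first: it fixes the value [- dualval (- C)] at [C], which the next
   minorant must keep. *)
have [P [sP Pd PC]] := sublinear_odd_at dualval (- C) dualval_sublinear.
have [Q [sQ QP Qd]] := sublinear_odd_seq P
  [seq delta_mx ij.1 ij.2 | ij : 'I_n * 'I_n] sP.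
have Qodd ij : odd_at Q (delta_mx ij.1 ij.2).
  by apply: Qd; apply/mapP; exists ij => //; rewrite mem_enum.
have QV h p : dom h p -> Q h <= val p.
  by move=> /dualval_le; apply: le_trans; exact: le_trans (QP h) (Pd h).
have QE h : odd_at Q h /\ Q h = \sum_i \sum_j h i j * Q (delta_mx i j).
  rewrite pair_big/= [h in odd_at _ h /\ Q h = _]matrix_sum_delta pair_big/=.
  exact: (odd_at_sum Q _ (fun ij => h ij.1 ij.2) (fun ij => delta_mx ij.1 ij.2)).
have sumN (x y : 'I_n -> R) : \sum_i x i * - y i = - \sum_i x i * y i.
  by rewrite -sumrN; apply: eq_bigr => i _; rewrite mulrN.
have sum0 (x : 'I_n -> R) : \sum_i x i * 0 = 0 by rewrite big1// => i _; rewrite mulr0.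
have sumd (x : 'I_n -> R) i : \sum_k x k * (k == i)%:R = x i.
  rewrite (bigD1 i)//= eqxx mulr1 big1 ?addr0// => k /negbTE ->.
  by rewrite mulr0.
exists (fun i j => Q (delta_mx i j)).
have [_ [p /= hp <-] hpe] := inf_adherent e0 (dom_inf (- C)).
exists (fun i => - p.1 i), (fun j => - p.2 j); split.
(* Zero potentials dominate [- delta_mx i j], so [Q] is at most 0 there. *)
- move=> i j; have := QV (- delta_mx i j) (fun=> 0, fun=> 0).
  rewrite (Qodd (i, j)) /val/= !sum0 addr0 oppr_le0; apply => k l /=.
  by rewrite !mxE addr0 oppr_le0 ler0n.
(* The indicator of row [i] is exactly the sum of the potentials [(k == i)%:R] and 0, and likewise
   for the opposites; this squeezes [Q h] to [a i]. Columns are symmetric. *)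
- move=> i; pose h : 'M[R]_n := \matrix_(k, l) (k == i)%:R.
  have <- : Q h = \sum_j Q (delta_mx i j).
    rewrite (QE h).2 (bigD1 i)//= [X in _ + X]big1 ?addr0 => [|k /negbTE ki].
      by apply: eq_bigr => j _; rewrite mxE eqxx mul1r.
    by apply: big1 => j _; rewrite mxE ki mul0r.
  apply/eqP; rewrite eq_le; apply/andP; split.
    have := QV h (fun k => (k == i)%:R, fun=> 0).
    rewrite /val/= sum0 addr0 sumd; apply => k l /=.
    by rewrite mxE addr0.
  have := QV (- h) (fun k => - (k == i)%:R, fun=> 0).
  rewrite (QE h).1 /val/= sum0 addr0 sumN sumd lerN2; apply => k l /=.
  by rewrite !mxE addr0.
- move=> j; pose h : 'M[R]_n := \matrix_(k, l) (l == j)%:R.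
  have <- : Q h = \sum_i Q (delta_mx i j).
    rewrite (QE h).2; apply: eq_bigr => i _.
    rewrite (bigD1 j)//= mxE eqxx mul1r big1 ?addr0// => l /negbTE lj.
    by rewrite mxE lj mul0r.
  apply/eqP; rewrite eq_le; apply/andP; split.
    have := QV h (fun=> 0, fun l => (l == j)%:R).
    rewrite /val/= sum0 add0r sumd; apply => k l /=.
    by rewrite mxE add0r.
  have := QV (- h) (fun=> 0, fun l => - (l == j)%:R).
  rewrite (QE h).1 /val/= sum0 add0r sumN sumd lerN2; apply => k l /=.
  by rewrite !mxE add0r.
- by move=> i j; have := hp i j; rewrite !mxE; lra.
- have -> : \sum_i \sum_j Q (delta_mx i j) * c i j = Q C.
    rewrite (QE C).2; apply: eq_bigr => i _; apply: eq_bigr => j _.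
    by rewrite mxE mulrC.
  (* There is no duality gap: [P] is odd at [C], so its minorant [Q] takes the same value there. *)
  have QC : Q C = - dualval (- C).
    rewrite -[in LHS](opprK C) -PC; apply: (odd_at_mono P Q _ sQ QP _).2.
    apply: odd_atN; have := sublinear_opp P (- C) sP; have := Pd (- C).
    by rewrite /odd_at PC; lra.
  by move: hpe; rewrite QC !sumN /val /dualval; lra.
Qed.
End FiniteKantorovich.

(** * Couplings and Lipschitz functions *)

Section IntegralPrelim.
Local Open Scope ereal_scope.
Context {R : realType} {d : measure_display} {T : measurableType d}.

Import HBNNSimple.

(* No measurability: the integral is a supremum over simple functions below. *)
Lemma le_integral_nonmeasurable (m : {measure set T -> \bar R}) (f g : T -> \bar R) :
  (forall x, 0 <= f x) -> (forall x, f x <= g x) -> \int[m]_x f x <= \int[m]_x g x.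
Proof.
move=> f0 fg; rewrite !ge0_integralTE//; last by move=> x; exact: le_trans (fg x).
apply: ereal_sup_le => _ [h /= hf <-]; exists h => //= x.
exact: le_trans (hf x) (fg x).
Qed.

Lemma integral_probability_cst (m : probability T R) (c : \bar R) : \int[m]_x c = c.
Proof.
apply: etrans (integral_cst m measurableT c) _.
exact: etrans (congr1 (fun x => c * x) (probability_setT m)) (mule1 _).
Qed.

(** A finite [B] is moved to the other side; for [B = +oo] the right-hand side is [+oo], since the
    infimum is nonnegative. *)
Lemma le_add_ereal_inf (A B : \bar R) (S : set (\bar R)) : 0 <= B ->
  (forall s, S s -> 0 <= s) -> (forall s, S s -> A <= B + s) ->
  A <= B + ereal_inf S.
Proof.
move=> B0 S0 AB; have I0 : 0 <= ereal_inf S by exact: le_ereal_inf_tmp.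
have [Bfin|] := boolP (B \is a fin_num).
  by rewrite -leeBlDl//; apply: le_ereal_inf_tmp => s Ss; rewrite leeBlDl//; exact: AB.
rewrite ge0_fin_numE// -leNgt leye_eq => /eqP ->.
by rewrite addye ?leey// gt_eqF// (lt_le_trans _ I0).
Qed.

Lemma integral_coupling_fst (alpha beta : probability T R) (gamma : probability (T * T)%type R)
    (f : T -> \bar R) : coupling alpha beta gamma ->
  measurable_fun setT f -> (forall x, 0 <= f x) ->
  \int[gamma]_z f z.1 = \int[alpha]_x f x.
Proof.
move=> cpl mf f0.
rewrite -(@ge0_integral_pushforward _ _ _ _ _ _ measurable_fst gamma setT f)//.
apply: eq_measure_integral => A mA _.
apply: etrans (cpl A mA).1; congr (gamma _).
by apply/seteqP; split => // z [].
Qed.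

Lemma integral_coupling_snd (alpha beta : probability T R) (gamma : probability (T * T)%type R)
    (f : T -> \bar R) : coupling alpha beta gamma ->
  measurable_fun setT f -> (forall x, 0 <= f x) ->
  \int[gamma]_z f z.2 = \int[beta]_x f x.
Proof.
move=> cpl mf f0.
rewrite -(@ge0_integral_pushforward _ _ _ _ _ _ measurable_snd gamma setT f)//.
apply: eq_measure_integral => A mA _.
apply: etrans (cpl A mA).2; congr (gamma _).
by apply/seteqP; split => // z [].
Qed.

Lemma coupling_product (alpha beta : probability T R) :
  coupling alpha beta (alpha \x beta : probability _ R).
Proof.
move=> A mA; split.
  apply: etrans (product_measure1E _ _ mA measurableT) _.
  exact: etrans (congr1 (fun x => alpha A * x) (probability_setT beta)) (mule1 _).
apply: etrans (product_measure1E _ _ measurableT mA) _.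
exact: etrans (congr1 (fun x => x * beta A) (probability_setT alpha)) (mul1e _).
Qed.

Section disintegration_integral.
Variables (pi : probability (T * T)%type R) (mu nu : probability T R).
Variable k : T -> probability T R.
Hypotheses (cpl : coupling mu nu pi) (dis : disintegration pi mu k).

Lemma measurable_integral_disintegration (h : T -> \bar R) :
  measurable_fun setT h -> (forall x, 0 <= h x) ->
  measurable_fun setT (fun x => \int[k x]_y h y).
Proof.
move=> mh h0; apply: measurable_fun_integral_kernel => //; exact: dis.1.
Qed.

(** The second marginal is the mixture of the kernels: on measurable sets it agrees with the Giry
    bind of [mu] and [k], whose integrals are iterated ones. *)
Lemma integral_disintegration (h : T -> \bar R) :
  measurable_fun setT h -> (forall x, 0 <= h x) ->
  \int[nu]_y h y = \int[mu]_x \int[k x]_y h y.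
Proof.
move=> mh h0; have mk : measurable_fun setT (k : T -> giry T R).
  by apply: measurable_giry_codensity => //; exact: dis.1.
have := @giry_int_bind _ _ _ _ _ (mu : giry T R) _ mk h mh h0.
rewrite /giry_int => <-; apply: eq_measure_integral => A mA _.
have := @giry_int_bind _ _ _ _ _ (mu : giry T R) _ mk (fun x => (\1_A x)%:E).
rewrite /giry_int integral_indic// setIT => ->.
- apply: etrans (esym (cpl A mA).2) _; rewrite dis.2//; apply: eq_integral => x _.
  by rewrite integral_indic// setIT.
- exact/measurable_EFinP.
- by move=> x; rewrite lee_fin.
Qed.
End disintegration_integral.
End IntegralPrelim.

(** * Measurability of the distance, and elementary bounds on the Wasserstein distance *)

Section Metric.
Context {R : realType} {d : measure_display} {T : measurableType d}
  (dist : T -> T -> R).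
Hypotheses (dist_metric : is_metric dist) (dist_sep : dist_separable dist).
Hypothesis dist_borel : borel_of_dist dist.

Lemma dist_ge0 x y : 0 <= dist x y.
Proof. by case: dist_metric. Qed.
Lemma distxx x : dist x x = 0.
Proof. by case: dist_metric => _ + _ _ => /(_ x x)[_ ->]. Qed.
Lemma dist_sym x y : dist x y = dist y x.
Proof. by case: dist_metric. Qed.
Lemma dis_tri x y z : dist x z <= dist x y + dist y z.
Proof. by case: dist_metric. Qed.

Definition lip1 (F : T -> R) := forall x y, F x <= F y + dist x y.

Lemma lip1_dist x : lip1 (dist x).
Proof. by move=> y z; rewrite (dist_sym y z) dis_tri. Qed.

(** The set where [F > a] is open: around [x] the radius [F x - a] works. *)
Lemma lip1_measurable F : lip1 F -> measurable_fun setT F.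
Proof.
move=> FL; apply: (measurability _ (RGenOInfty.measurableE R)) => //.
move=> _ [_ [a ->] <-]; rewrite setTI dist_borel; apply: sub_sigma_algebra.
move=> x /=; rewrite in_itv/= andbT => ax; exists (F x - a); first lra.
by move=> y xy; rewrite in_itv/= andbT; have := FL x y; lra.
Qed.

(** Separability brings the distance into the product sigma-algebra: [dist z.1 z.2 < a] holds iff
    some dense point has distances to [z.1] and [z.2] of sum below [a]. *)
Lemma measurable_dist_pair : measurable_fun setT (fun z : T * T => dist z.1 z.2).
Proof.
have [s sP] := dist_sep.
apply: (measurability _ (RGenInftyO.measurableE R)) => //.
move=> _ [_ [a ->] <-]; rewrite setTI.
pose h n (z : T * T) := dist (s n) z.1 + dist (s n) z.2.
rewrite [X in measurable X](_ : _ = \bigcup_n (setT `&` h n @^-1` `]-oo, a[)).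
  apply: bigcup_measurable => n _.
  have mh : measurable_fun setT (h n).
    by apply: measurable_funD; apply: measurableT_comp => //;
      exact/lip1_measurable/lip1_dist.
  exact: mh.
apply/seteqP; split => [z|z [n _] [_]]; rewrite /= /h !in_itv/=; last first.
  by have := dis_tri z.1 (s n) z.2; rewrite (dist_sym z.1 (s n)); lra.
(* Half of the gap is enough, as [dist (s n) z.1] is counted twice: once itself and once in the
   bound for [dist (s n) z.2]. *)
move=> za; have [n zn] := sP z.1 ((a - dist z.1 z.2) / 2) ltac:(lra).
exists n => //; split => //; rewrite /= in_itv/= (dist_sym _ z.1).
by have := dis_tri (s n) z.1 z.2; rewrite (dist_sym _ z.1); lra.
Qed.

Local Open Scope ereal_scope.

Lemma Wass_ge0 (alpha beta : probability T R) : 0 <= Wass dist alpha beta.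
Proof.
apply: le_ereal_inf_tmp => _ [g _ <-]; apply: integral_ge0 => z _.
by rewrite lee_fin dist_ge0.
Qed.

Lemma measurable_EFin_lip1 F : lip1 F -> measurable_fun setT (EFin \o F).
Proof. by move=> /lip1_measurable ?; exact/measurable_EFinP. Qed.

Lemma measurable_EFin_dist_pair :
  measurable_fun setT (fun z : T * T => (dist z.1 z.2)%:E).
Proof. by apply/measurable_EFinP; exact: measurable_dist_pair. Qed.

(** The easy half of duality: integrate [F x <= F y + dist x y] over a coupling. The additive form
    stays meaningful for infinite integrals. *)
Lemma integral_lip1_le_fst F (alpha beta : probability T R) : lip1 F -> (forall x, (0 <= F x)%R) ->
  \int[alpha]_x (F x)%:E <= \int[beta]_x (F x)%:E + Wass dist alpha beta.
Proof.
move=> FL F0; have mF := measurable_EFin_lip1 F FL.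
apply: le_add_ereal_inf; first by apply: integral_ge0 => x _; rewrite lee_fin.
  by move=> _ [g _ <-]; apply: integral_ge0 => z _; rewrite lee_fin dist_ge0.
move=> _ [g cpl <-].
rewrite -(integral_coupling_fst _ _ _ (EFin \o F) cpl)//.
rewrite -(integral_coupling_snd _ _ _ (EFin \o F) cpl)//.
have mF1 : measurable_fun setT (fun z : T * T => (F z.1)%:E).
  exact: (measurableT_comp mF measurable_fst).
have mF2 : measurable_fun setT (fun z : T * T => (F z.2)%:E).
  exact: (measurableT_comp mF measurable_snd).
have mD := measurable_EFin_dist_pair.
rewrite -ge0_integralD//=; last 2 first.
- by move=> z _; rewrite lee_fin.
- by move=> z _; rewrite lee_fin dist_ge0.
apply: ge0_le_integral => //.
- by move=> z _; rewrite lee_fin.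
- exact: emeasurable_funD.
- by move=> z _; rewrite -EFinD lee_fin.
Qed.

Lemma Wass_sym_le (alpha beta : probability T R) : Wass dist beta alpha <= Wass dist alpha beta.
Proof.
apply: le_ereal_inf_tmp => _ [g cpl <-].
pose sw : {mfun (T * T)%type >-> (T * T)%type} := HB.pack (fun z : (T * T)%type => (z.2, z.1))
  (isMeasurableFun.Build _ _ _ _ _ (@measurable_swap _ _ T T)).
have mD := measurable_EFin_dist_pair.
apply: ereal_inf_lbound; exists (distribution g sw).
  by move=> A mA; have [gA1 gA2] := cpl A mA; split;
    [rewrite -gA2|rewrite -gA1]; congr (g _); apply/seteqP; split => -[x y] [].
rewrite ge0_integral_distribution//; last by move=> z; rewrite lee_fin dist_ge0.
by apply: eq_integral => -[x y] _ /=; rewrite dist_sym.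
Qed.

Lemma Wass_sym (alpha beta : probability T R) : Wass dist alpha beta = Wass dist beta alpha.
Proof. by apply/eqP; rewrite eq_le !Wass_sym_le. Qed.

Lemma integral_lip1_le_snd F (alpha beta : probability T R) : lip1 F -> (forall x, (0 <= F x)%R) ->
  \int[beta]_x (F x)%:E <= \int[alpha]_x (F x)%:E + Wass dist alpha beta.
Proof. by rewrite Wass_sym; exact: integral_lip1_le_fst. Qed.

Lemma Wass_le_product (alpha beta : probability T R) :
  Wass dist alpha beta <= \int[alpha]_x \int[beta]_y (dist x y)%:E.
Proof.
have mD := measurable_EFin_dist_pair.
rewrite -(fubini_tonelli1 (EFin \o (fun z => dist z.1 z.2)))//; last first.
  by move=> z; rewrite lee_fin dist_ge0.
apply: ereal_inf_lbound; exists (alpha \x beta : probability _ R) => //.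
exact: coupling_product.
Qed.

End Metric.

(** * Kantorovich duality *)

Section FiniteValued.
Local Open Scope ereal_scope.
Context {R : realType} {d : measure_display} {T : measurableType d} {I : finType}.
Variable Q : T -> I.
Hypothesis mQ : forall i, measurable (Q @^-1` [set i]).

Lemma finite_valued_sum (f : I -> R) x :
  (f (Q x))%:E = \sum_i (f i)%:E * (\1_(Q @^-1` [set i]) x)%:E.
Proof.
rewrite (bigD1 (Q x))//= indicE mem_set//= mule1 big1 ?adde0// => i iQ.
by rewrite indicE memNset ?mule0//= => Qi; rewrite Qi eqxx in iQ.
Qed.

Lemma measurable_finite_valued (f : I -> R) : measurable_fun setT (fun x => (f (Q x))%:E).
Proof.
under eq_fun do rewrite finite_valued_sum.
apply: emeasurable_sum => i; apply: measurable_funeM.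
by apply/measurable_EFinP; exact: measurable_indic.
Qed.

Lemma integral_finite_valued (m : {measure set T -> \bar R}) (f : I -> R) :
  (forall i, (0 <= f i)%R) ->
  \int[m]_x (f (Q x))%:E = \sum_i (f i)%:E * m (Q @^-1` [set i]).
Proof.
move=> f0; under eq_integral do rewrite finite_valued_sum.
have mi i : measurable_fun setT (fun x => (\1_(Q @^-1` [set i]) x : R)%:E).
  by apply/measurable_EFinP; exact: measurable_indic.
rewrite ge0_integral_sum//; last 2 first.
- by move=> i; exact: measurable_funeM.
- by move=> i x _; rewrite mule_ge0// lee_fin.
apply: eq_bigr => i _; rewrite ge0_integralZl ?lee_fin//.
by rewrite integral_indic// setIT.
Qed.

Lemma measure_finite_valued (m : {measure set T -> \bar R}) (B : set T) : measurable B ->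
  m B = \sum_i m (B `&` Q @^-1` [set i]).
Proof.
move=> mB; rewrite -[in LHS](setIT B) -[LHS]integral_indic//.
have E x : (\1_B x : R)%:E = \sum_i (\1_(B `&` Q @^-1` [set i]) x)%:E.
  rewrite (bigD1 (Q x))//= big1 ?adde0.
    by rewrite !indicE in_setI (mem_set (erefl : (Q @^-1` [set Q x]) x)) andbT.
  move=> i iQ; rewrite indicE memNset//= => -[_ Qi].
  by rewrite Qi eqxx in iQ.
under eq_integral do rewrite E.
rewrite ge0_integral_sum//; last first.
  by move=> i; apply/measurable_EFinP; apply: measurable_indic; exact: measurableI.
by apply: eq_bigr => i _; rewrite integral_indic ?setIT//; exact: measurableI.
Qed.

End FiniteValued.

(** * From a plan between cells to a coupling of the measures *)

Section PartitionCoupling.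
Context {R : realType} {d : measure_display} {T : measurableType d} {n : nat}.
Variables (alpha beta : probability T R) (q : T -> 'I_n.+1) (p : 'I_n.+1 -> 'I_n.+1 -> R).
Let C i := q @^-1` [set i].
Hypothesis mC : forall i, measurable (C i).
Hypothesis p0 : forall i j, 0 <= p i j.
Hypothesis palpha : forall i, \sum_j p i j = fine (alpha (C i)).
Hypothesis pbeta : forall j, \sum_i p i j = fine (beta (C j)).

(** The density on [C i] times [C j] with respect to the product measure. Over a null cell, division
    by 0 gives density 0, consistent with [p i j = 0] there. *)
Let w i j := p i j / (fine (alpha (C i)) * fine (beta (C j))).
Let w0 i j : 0 <= w i j.
Proof. by rewrite /w divr_ge0 ?mulr_ge0 ?fine_ge0. Qed.

Let mCC i j : measurable (C i `*` C j).
Proof. exact: measurableX. Qed.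

Let gamma0 : {measure set (T * T) -> \bar R} :=
  msum (fun i => msum (fun j =>
    mscale (NngNum (w0 (inord i) (inord j)))
      (mrestr (alpha \x beta)%E (mCC (inord i) (inord j)))) n.+1) n.+1.

Let gamma0E B D : measurable B -> measurable D ->
  gamma0 (B `*` D) = (\sum_i \sum_j
    w i j * (fine (alpha (B `&` C i)) * fine (beta (D `&` C j))))%:E.
Proof.
move=> mB mD; rewrite /gamma0/= /msum -sumEFin; apply: eq_bigr => i _.
rewrite -sumEFin; apply: eq_bigr => j _.
rewrite /= /mscale/= /mrestr !inord_val -setXI -/(w i j) [RHS]EFinM; congr (_ * _)%E.
apply: etrans (product_measure1E _ _ (measurableI _ _ mB (mC i)) (measurableI _ _ mD (mC j))) _.
by rewrite EFinM !fineK// fin_num_measure//; exact: measurableI.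
Qed.

(** A nonnegative entry is at most its row sum and its column sum. *)
Let sum_p_eq0 i j : fine (alpha (C i)) = 0 \/ fine (beta (C j)) = 0 -> p i j = 0.
Proof.
move=> [|] ab0; apply/eqP; rewrite eq_le p0 andbT.
  by rewrite -ab0 -palpha (bigD1 j)//= lerDl sumr_ge0.
by rewrite -ab0 -pbeta (bigD1 i)//= lerDl sumr_ge0.
Qed.

Let wK i j : w i j * (fine (alpha (C i)) * fine (beta (C j))) = p i j.
Proof.
rewrite /w; have [ab0|ab0] := eqVneq (fine (alpha (C i)) * fine (beta (C j))) 0.
  rewrite ab0 mulr0 sum_p_eq0//.
  by move/eqP: ab0; rewrite mulf_eq0 => /orP[/eqP|/eqP]; [left|right].
by rewrite divfK.
Qed.

Let fine_cell (m : probability T R) B i : measurable B ->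
  fine (m (C i)) = 0 -> fine (m (B `&` C i)) = 0.
Proof.
move=> mB /eqP; rewrite fine_eq0 ?fin_num_measure// => /eqP m0.
apply/eqP; rewrite fine_eq0 ?fin_num_measure//; last exact: measurableI.
rewrite -measure_le0 -m0; apply: le_measure; rewrite ?inE//.
exact: measurableI.
Qed.

Let sum_fine_cell (m : probability T R) B : measurable B ->
  (\sum_i fine (m (B `&` C i)))%:E = m B.
Proof.
move=> mB; rewrite (measure_finite_valued q mC m B mB) -sumEFin.
apply: eq_bigr => i _; rewrite fineK// fin_num_measure//.
exact: measurableI.
Qed.

Let gamma0_fst B : measurable B -> gamma0 (B `*` setT) = alpha B.
Proof.
move=> mB; rewrite gamma0E//; apply: etrans (sum_fine_cell alpha B mB).
congr EFin; apply: eq_bigr => i _; have [ai|ai] := eqVneq (fine (alpha (C i))) 0.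
  by rewrite fine_cell// big1// => j _; rewrite mul0r mulr0.
have E j : w i j * (fine (alpha (B `&` C i)) * fine (beta (setT `&` C j))) =
    p i j * (fine (alpha (B `&` C i)) / fine (alpha (C i))).
  by rewrite -[p i j]wK setTI !mulrA; field.
by rewrite (eq_bigr _ (fun j _ => E j)) -mulr_suml palpha mulrC divfK.
Qed.

Let gamma0_snd B : measurable B -> gamma0 (setT `*` B) = beta B.
Proof.
move=> mB; rewrite gamma0E//; apply: etrans (sum_fine_cell beta B mB).
congr EFin; rewrite exchange_big/=.
apply: eq_bigr => i _; have [ai|ai] := eqVneq (fine (beta (C i))) 0.
  by rewrite fine_cell// big1// => j _; rewrite !mulr0.
have E j : w j i * (fine (alpha (setT `&` C j)) * fine (beta (B `&` C i))) =
    p j i * (fine (beta (B `&` C i)) / fine (beta (C i))).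
  by rewrite -[p j i]wK setTI !mulrA; field.
by rewrite (eq_bigr _ (fun j _ => E j)) -mulr_suml pbeta mulrC divfK.
Qed.

Let gamma0_cell i j : gamma0 (C i `*` C j) = (p i j)%:E.
Proof.
rewrite gamma0E//; congr EFin.
have CC0 k l : l != k -> C k `&` C l = set0.
  move=> kl; apply/seteqP; split => // x []; rewrite /C /= => -> lk.
  by rewrite lk eqxx in kl.
rewrite (bigD1 i)//= [X in _ + X]big1 ?addr0; last first.
  by move=> k ki; rewrite big1// => l _; rewrite CC0// measure0 mul0r mulr0.
rewrite (bigD1 j)//= [X in _ + X]big1 ?addr0; last first.
  by move=> k kj; rewrite (CC0 j)// measure0 !mulr0.
by rewrite !setIid wK.
Qed.

(* Spread the mass [p i j] over the rectangle [C i `*` C j] proportionally to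
   the product measure. *)
Lemma partition_coupling : exists gamma : probability (T * T)%type R,
  coupling alpha beta gamma /\ forall i j, gamma (C i `*` C j) = (p i j)%:E.
Proof.
have g1 : gamma0 setT = 1%E by rewrite -setXTT gamma0_fst// probability_setT.
(* The total mass is already 1, so normalization leaves the measure unchanged and only supplies the
   probability structure; the product measure is the default value. *)
exists (mnormalize gamma0 ((alpha \x beta)%E : probability _ R)).
have E A : mnormalize gamma0 ((alpha \x beta)%E : probability _ R) A = gamma0 A.
  by rewrite /mnormalize g1 /= onee_eq0/= invr1 mule1.
by split=> [A mA|i j]; rewrite /= !E ?gamma0_fst ?gamma0_snd ?gamma0_cell.
Qed.

End PartitionCoupling.

(** * The countable family of cones, and quantization to finitely many points *)

Section Duality.
Context {R : realType} {d : measure_display} {T : measurableType d}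
  (dist : T -> T -> R) (s : nat -> T).
Hypothesis dist_metric : is_metric dist.
Hypothesis s_dense : forall x (e : R), 0 < e -> exists n, dist x (s n) < e.
Hypothesis dist_borel : borel_of_dist dist.

Let dist_sep : dist_separable dist.
Proof. by exists s. Qed.

Let dist_ge0 := dist_ge0 dist dist_metric.
Let dist_sym := dist_sym dist dist_metric.
Let dis_tri := dis_tri dist dist_metric.

(* The absolute value keeps integrals in [0, +oo] without integrability conditions;
   rational heights keep the family countable. *)
Definition cone (c : rat * nat) (x : T) : R := `|ratr c.1| + dist (s c.2) x.
Definition cones (c : rat * nat) (l : seq (rat * nat)) (x : T) : R :=
  \big[Order.min/cone c x]_(b <- l) cone b x.
(** An integer coding no list yields the cone of height 0 at [s 0], so every index gives a member of
    the family. *)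
Definition cones_enum (n : nat) : T -> R :=
  let: (c, l) := odflt ((0%Q, 0%N), [::]) (unpickle n) in cones c l.

Lemma cones_enum_pickle c l : cones_enum (pickle (c, l)) = cones c l.
Proof. by rewrite /cones_enum pickleK. Qed.

Lemma cones_ge0 c l x : 0 <= cones c l x.
Proof. by apply: le_bigmin => [|b _]; rewrite addr_ge0. Qed.

Lemma lip1_cones c l : lip1 dist (cones c l).
Proof.
have H b x y : cone b x <= cone b y + dist x y.
  by rewrite /cone -addrA lerD2l (dist_sym x y) dis_tri.
move=> x y; rewrite /cones; elim: l => [|b l IH]; first by rewrite !big_nil.
by rewrite !big_cons addr_minl le_min !ge_min H IH orbT.
Qed.

Lemma cones_enum_ge0 n x : 0 <= cones_enum n x.
Proof. by rewrite /cones_enum; case: (odflt _ _) => c l; exact: cones_ge0. Qed.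

Lemma lip1_cones_enum n : lip1 dist (cones_enum n).
Proof. by rewrite /cones_enum; case: (odflt _ _) => c l; exact: lip1_cones. Qed.

Section Quantization.
Variables (e : R) (N : nat).

Let near i x := dist (s i) x < e.
(** The last index [N] stands for the cell of points far from [s 0], ..., [s (N - 1)]; its
    representative is [s 0]. *)
Let idx (i : 'I_N.+1) := if (i < N)%N then (i : nat) else 0%N.

Lemma quantize_subproof x : (find (near^~ x) (iota 0 N) < N.+1)%N.
Proof. by rewrite ltnS -[leqRHS](size_iota 0) find_size. Qed.

Definition quantize x : 'I_N.+1 := Ordinal (quantize_subproof x).
Definition qpoint (i : 'I_N.+1) := s (idx i).
Definition far : set T := fun x => forall j, (j < N)%N -> e <= dist (s j) x.

Lemma quantize_le (m : nat) x : (m <= N)%N -> (m <= quantize x)%N <-> (forall j, (j < m)%N -> e <= dist (s j) x).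
Proof.
move=> mN; split=> [mq j jm|mfar].
  have /= /negbT := before_find 0%N (leq_trans jm mq).
  by rewrite nth_iota ?add0n ?(leq_trans jm)// /near -leNgt.
rewrite leqNgt; apply/negP => qm.
have qN : (quantize x < N)%N by exact: leq_trans mN.
have /(nth_find 0%N) : has (near^~ x) (iota 0 N) by rewrite has_find size_iota.
by rewrite nth_iota// add0n /near ltNge mfar.
Qed.

(** A point near one of the first [N] centres moves by less than [e], any other is sent to [s 0].
    The absolute value makes the bound hold in the second case whatever the sign of [e]. *)
Lemma quantize_dist x : dist (qpoint (quantize x)) x <= `|e| + dist (s 0) x * \1_far x.
Proof.
rewrite /qpoint /idx; case: ifPn => [qN|].
  have /(nth_find 0%N) : has (near^~ x) (iota 0 N) by rewrite has_find size_iota.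
  rewrite nth_iota// add0n /near => /ltW h.
  by rewrite (le_trans h)// (le_trans (ler_norm e))// lerDl mulr_ge0.
rewrite -leqNgt => /(quantize_le N x (leqnn N)) => xfar.
rewrite indicE mem_set//.
by rewrite mulr1 lerDr.
Qed.

Let mball j : measurable [set x | e <= dist (s j) x].
Proof.
have := @lip1_measurable _ _ _ dist dist_borel _ (lip1_dist dist dist_metric (s j)).
move=> /(_ measurableT `[e, +oo[%classic (measurable_itv _)); rewrite setTI.
by congr measurable; apply/seteqP; split => x; rewrite /= in_itv/= andbT.
Qed.

Lemma measurable_far_upto m : measurable [set x | forall j, (j < m)%N -> e <= dist (s j) x].
Proof.
have -> : [set x | forall j, (j < m)%N -> e <= dist (s j) x] =
    \bigcap_(j in [set j | (j < m)%N]) [set x | e <= dist (s j) x].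
  by apply/seteqP; split.
by apply: bigcap_measurableType => j _; exact: mball.
Qed.

Lemma measurable_quantize i : measurable (quantize @^-1` [set i]).
Proof.
pose G m := [set x | (m <= quantize x)%N].
have mG m : measurable (G m).
  have [mN|mN] := leqP m N; last first.
    have -> : G m = set0.
      apply/seteqP; split => // x mq.
      by have := leq_trans (leq_ltn_trans mq (ltn_ord (quantize x))) mN; rewrite ltnn.
    exact: measurable0.
  have -> : G m = [set x | forall j, (j < m)%N -> e <= dist (s j) x].
    by apply/seteqP; split => x /(quantize_le m x mN).
  exact: measurable_far_upto.
have -> : quantize @^-1` [set i] = G i `\` G i.+1; last exact: measurableD.
apply/seteqP; split => x /=; rewrite /G /=; first by move=> <-; rewrite ltnn.
by move=> [ix /negP]; rewrite -leqNgt => xi; apply/val_inj/eqP; rewrite eqn_leq ix xi.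
Qed.

Lemma measurable_far : measurable far.
Proof. exact: measurable_far_upto. Qed.

Lemma measurable_quantize_dist :
  measurable_fun setT (fun x => (dist (qpoint (quantize x)) x)%:E).
Proof.
have mq : measurable_fun setT (qpoint \o quantize).
  move=> _ B mB; rewrite setTI.
  have -> : (qpoint \o quantize) @^-1` B =
      \bigcup_(i in [set i | B (qpoint i)]) quantize @^-1` [set i].
    by apply/seteqP; split => [x /= Bx|x [i /= Bi]]; [exists (quantize x)|move=> ->].
  by apply: fin_bigcup_measurable => [|i _]; [exact: finite_finset|exact: measurable_quantize].
have := measurable_EFin_dist_pair dist dist_metric dist_sep dist_borel.
move=> /measurableT_comp/(_ (measurable_fun_pair mq (@measurable_id _ T setT))).
exact.
Qed.

End Quantization.

(** By density the far sets shrink to the empty set, so dominated convergence with dominating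
    function [dist (s 0)] makes their contribution at most [e]; the near cells contribute the other
    [e]. *)
Lemma integral_quantize_dist (alpha : probability T R) (e : R) : 0 < e ->
  (\int[alpha]_x (dist (s 0) x)%:E < +oo)%E ->
  \forall N \near \oo,
    (\int[alpha]_x (dist (qpoint N (quantize e N x)) x)%:E <= (2 * e)%:E)%E.
Proof.
move=> e0 afin.
pose f N x := (dist (s 0) x * \1_(far e N) x)%:E.
have mdist : measurable_fun setT (fun x => dist (s 0) x).
  exact/(lip1_measurable dist dist_borel)/(lip1_dist dist dist_metric).
have mf N : measurable_fun setT (f N).
  apply/measurable_EFinP/measurable_funM => //.
  by apply: measurable_indic; exact: measurable_far.
have f0 N x : (0 <= f N x)%E by rewrite lee_fin mulr_ge0.
have fcvg x : f ^~ x @ \oo --> (0%E : \bar R).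
  have [n0 xn0] := s_dense x e e0; apply: cvg_near_cst; near=> n.
  rewrite /f indicE memNset ?mulr0// => /(_ n0) /=.
  by rewrite leNgt dist_sym xn0 => /(_ _)/negP; apply; near: n; exists n0.+1.
have int0 : alpha.-integrable setT (fun x => (dist (s 0) x)%:E).
  apply/integrableP; split; first exact/measurable_EFinP.
  by under eq_integral do rewrite gee0_abs ?lee_fin//.
have fle x n : (`|f n x| <= (dist (s 0) x)%:E)%E.
  by rewrite gee0_abs// lee_fin ler_piMr// indicE lern1 leq_b1.
have [_ _] := dominated_convergence measurableT mf (measurable_cst _)
  (aeW alpha (fun x _ => fcvg x)) int0 (aeW alpha (fun x n _ => fle x n)).
rewrite integral0 => cvf.
suff H : \forall N \near \oo, (\int[alpha]_x f N x <= e%:E)%E.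
  near=> N; apply: (@le_trans _ _ (\int[alpha]_x (e%:E + f N x))%E).
    apply: ge0_le_integral => //.
    - by move=> x _; rewrite lee_fin.
    - exact: measurable_quantize_dist.
    - exact: emeasurable_funD.
    - move=> x _; rewrite -EFinD lee_fin; apply: le_trans (quantize_dist e N x) _.
      by rewrite ger0_norm// ltW.
  rewrite ge0_integralD//; last by move=> x _; rewrite lee_fin ltW.
  rewrite integral_cst// [X in (_ * X)%E]probability_setT mule1 mulr_natl mulr2n EFinD leeD2l//.
  by near: N.
have /fine_cvgP[ffin /cvgr_le/(_ _ e0) fle_e] := cvf.
near=> N; rewrite -[leLHS]fineK ?lee_fin; first by near: N.
by near: N.
Unshelve. all: end_near. Qed.
End Duality.

(** * Approximate duality for arbitrary measures with finite first moment *)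

Section Duality.
Context {R : realType} {d : measure_display} {T : measurableType d}
  (dist : T -> T -> R) (s : nat -> T).
Hypothesis dist_metric : is_metric dist.
Hypothesis s_dense : forall x (e : R), 0 < e -> exists n, dist x (s n) < e.
Hypothesis dist_borel : borel_of_dist dist.

Let dist_sep : dist_separable dist.
Proof. by exists s. Qed.

Let dist_ge0 := dist_ge0 dist dist_metric.
Let dist_sym := dist_sym dist dist_metric.
Let dis_tri := dis_tri dist dist_metric.

Lemma rat_between (x e : R) : 0 < e -> exists r : rat, x <= ratr r <= x + e.
Proof.
move=> e0; have [r] := @rat_in_itvoo R x (x + e) ltac:(by rewrite ltrDl).
by rewrite in_itv/= => /andP[/ltW xr /ltW rx]; exists r; rewrite xr rx.
Qed.

(* Cones based at the quantization points and with heights [- psi] separate [alpha] and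
   [beta] as much as the finite dual potentials do. *)
Lemma cones_of_potentials n (q : 'I_n.+1 -> nat) (phi psi : 'I_n.+1 -> R) (e : R) :
  0 < e -> (forall i j, phi i + psi j <= dist (s (q i)) (s (q j))) ->
  exists (M : R) c l, 
   [/\ forall i, 0 <= phi i + M,
       forall i, phi i + M <= cones dist s c l (s (q i)) &
       forall i x, cones dist s c l x <= M + e - psi i + dist (s (q i)) x].
Proof.
(* This shift makes [phi i + M] nonnegative, and also the heights [M - psi i], so that the absolute
   value in [cone] has no effect. *)
move=> e0 pp; pose M := \sum_i (`|phi i| + `|psi i|).
have Mge i : `|phi i| + `|psi i| <= M.
  by rewrite /M (bigD1 i)//= lerDl sumr_ge0// => j _; rewrite addr_ge0.
have rP (i : 'I_n.+1) : {r : rat | M - psi i <= ratr r <= M - psi i + e}.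
  exact/cid/rat_between.
pose b i := (sval (rP i), q i).
have bP i : M - psi i <= `|ratr (b i).1| <= M - psi i + e.
  have := svalP (rP i); rewrite /b/=; set r := ratr _ => /andP[r1 r2].
  rewrite ger0_norm ?r1//; apply: le_trans r1.
  by have := Mge i; have := ler_norm (psi i); have := normr_ge0 (phi i); lra.
exists M, (b ord0), [seq b i | i : 'I_n.+1]; split.
- move=> i; have := Mge i; have := ler_norm (- phi i).
  by rewrite normrN; have := normr_ge0 (psi i); lra.
- move=> i.
  have H j : phi i + M <= cone dist s (b j) (s (q i)).
    have := bP j; have := pp i j; rewrite /cone/= (dist_sym (s (q j))).
    by move=> ? /andP[]; lra.
  rewrite /cones big_map; apply: le_bigmin => [|j _]; exact: H.
- move=> i x; apply: (@le_trans _ _ (cone dist s (b i) x)).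
    by apply: ge_bigmin_seq => //; apply: map_f; rewrite mem_enum.
  by rewrite /cone lerD2r; have /andP[_] := bP i; lra.
Qed.

(** Quantize, solve the finite problem, and lift both its plan and its potentials. In [10 * e], each
    of the two quantization errors, at most [2 * e], is paid once by the plan and once by the
    potentials; near-optimality and rational rounding cost [e] each. *)
Lemma Wass_le_cones (alpha beta : probability T R) (e : R) : 0 < e ->
  (\int[alpha]_x (dist (s 0) x)%:E < +oo)%E ->
  (\int[beta]_x (dist (s 0) x)%:E < +oo)%E ->
  exists n, (Wass dist alpha beta <= \int[alpha]_x (cones_enum dist s n x)%:E
     - \int[beta]_x (cones_enum dist s n x)%:E + (10 * e)%:E)%E.
Proof.
move=> e0 afin bfin.
have [N [] aN bN] : exists N, 
   (\int[alpha]_x (dist (qpoint s N (quantize dist s e N x)) x)%:E <= (2 * e)%:E)%E /\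
   (\int[beta]_x (dist (qpoint s N (quantize dist s e N x)) x)%:E <= (2 * e)%:E)%E.
  have near_ab := filterI
    (integral_quantize_dist dist s dist_metric s_dense dist_borel alpha e e0 afin)
    (integral_quantize_dist dist s dist_metric s_dense dist_borel beta e e0 bfin).
  by have [N] := filter_ex (near_ab _); exists N.
pose q := quantize dist s e N; pose pt := qpoint s N.
pose E x := dist (pt (q x)) x.
have mE : measurable_fun setT (fun x => (E x)%:E).
  exact: (measurable_quantize_dist dist s dist_metric s_dense dist_borel).
have E0 x : 0 <= E x by exact: dist_ge0.
have mq : forall i, measurable (q @^-1` [set i]) by move=> i; exact: (measurable_quantize dist s dist_metric dist_borel).
pose a i := fine (alpha (q @^-1` [set i])).
pose b i := fine (beta (q @^-1` [set i])).
have sum_cells (m : probability T R) : \sum_i fine (m (q @^-1` [set i])) = 1.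
  apply: EFin_inj; rewrite -(probability_setT m) -sumEFin.
  rewrite [RHS](measure_finite_valued q mq m _ measurableT).
  by apply: eq_bigr => i _; rewrite fineK ?fin_num_measure// setTI.
have int_cells (m : probability T R) (f : 'I_N.+1 -> R) : (forall i, 0 <= f i) ->
    (\int[m]_x (f (q x))%:E = (\sum_i fine (m (q @^-1` [set i])) * f i)%:E)%E.
  move=> f0; rewrite (integral_finite_valued q mq m f f0) -sumEFin.
  by apply: eq_bigr => i _; rewrite EFinM fineK ?fin_num_measure// muleC.
have [p [phi [psi [p0 pa pb pp pcost]]]] :=
  @finite_kantorovich R N.+1 a b (fun i j => dist (pt i) (pt j))
    (fun i => fine_ge0 (measure_ge0 _ _)) (fun i => fine_ge0 (measure_ge0 _ _))
    (sum_cells alpha) (sum_cells beta) e e0.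
have [gamma [gcpl gcell]] := partition_coupling alpha beta q p mq p0 pa pb.
have [M [c [l [phiM phi_le le_psi]]]] :=
  cones_of_potentials N (fun i => if (i < N)%N then (i : nat) else 0%N) phi psi e e0 pp.
exists (pickle (c, l)); set F := cones_enum dist s _.
have FE x : F x = cones dist s c l x by rewrite /F cones_enum_pickle.
have F0 x : 0 <= F x by exact: cones_enum_ge0.
have FL : lip1 dist F by exact: lip1_cones_enum.
have mF : measurable_fun setT (fun x => (F x)%:E).
  exact: (measurable_EFin_lip1 dist dist_borel F FL).
(* A path from [z.1] to [z.2] goes through both representatives; the middle piece integrates to the
   cost of the finite plan. *)
have W_le : (Wass dist alpha beta <= \int[alpha]_x (E x)%:E + \int[beta]_x (E x)%:E
    + (\sum_i \sum_j p i j * dist (pt i) (pt j))%:E)%E.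
  apply: (@le_trans _ _ (\int[gamma]_z (dist z.1 z.2)%:E)%E).
    by apply: ereal_inf_lbound; exists gamma.
  rewrite -(integral_coupling_fst _ _ _ _ gcpl mE) ?lee_fin//.
  rewrite -(integral_coupling_snd _ _ _ _ gcpl mE) ?lee_fin//.
  pose Q (z : T * T) := (q z.1, q z.2).
  pose D (ij : 'I_N.+1 * 'I_N.+1) := dist (pt ij.1) (pt ij.2).
  have QE i j : Q @^-1` [set (i, j)] = q @^-1` [set i] `*` q @^-1` [set j].
    by apply/seteqP; split => -[x y]; rewrite /Q/= => -[<- <-].
  have mQ ij : measurable (Q @^-1` [set ij]).
    by case: ij => i j; rewrite QE; exact: measurableX.
  have mD := measurable_finite_valued Q mQ D.
  have D0 ij : 0 <= D ij by exact: dist_ge0.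
  have -> : (\sum_i \sum_j p i j * dist (pt i) (pt j))%:E =
      (\int[gamma]_z (D (Q z))%:E)%E.
    rewrite (integral_finite_valued Q mQ gamma D D0) pair_big/= -sumEFin.
    by apply: eq_bigr => -[i j] _ /=; rewrite QE [X in (_ * X)%E]gcell -EFinM mulrC.
  have mE1 : measurable_fun setT (fun z : T * T => (E z.1)%:E).
    exact: (measurableT_comp mE measurable_fst).
  have mE2 : measurable_fun setT (fun z : T * T => (E z.2)%:E).
    exact: (measurableT_comp mE measurable_snd).
  have mE12 := emeasurable_funD mE1 mE2.
  have mdist := measurable_EFin_dist_pair dist dist_metric dist_sep dist_borel.
  rewrite -ge0_integralD// -?ge0_integralD//; last 4 first.
  - by move=> z _; rewrite adde_ge0// lee_fin.
  - by move=> z _; rewrite lee_fin.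
  - by move=> z _; rewrite lee_fin.
  - by move=> z _; rewrite lee_fin.
  apply: ge0_le_integral => //.
  - by move=> z _; rewrite lee_fin.
  - exact: emeasurable_funD.
  - move=> z _; rewrite -!EFinD lee_fin /D/= /E (dist_sym (pt (q z.1)) z.1).
    have := dis_tri z.1 (pt (q z.1)) z.2.
    by have := dis_tri (pt (q z.1)) (pt (q z.2)) z.2; lra.
have alpha_le : ((\sum_i a i * (phi i + M))%:E <=
    \int[alpha]_x (F x)%:E + \int[alpha]_x (E x)%:E)%E.
  rewrite -(int_cells alpha (fun i => phi i + M))// -ge0_integralD//; last 2 first.
  - by move=> x _; rewrite lee_fin.
  - by move=> x _; rewrite lee_fin.
  apply: ge0_le_integral => //.
  - by move=> x _; rewrite lee_fin.
  - exact: (measurable_finite_valued q mq (fun i => phi i + M)).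
  - exact: emeasurable_funD.
  - move=> x _; rewrite -EFinD lee_fin; apply: le_trans (phi_le (q x)) _.
    by rewrite -FE; exact: FL.
(* Evaluate the upper bound on the nonnegative cones at [pt i], where the distance term vanishes. *)
have psi_ge0 i : 0 <= M + e - psi i.
  by have := le_trans (cones_ge0 dist s dist_metric c l _) (le_psi i (pt i)); rewrite distxx// addr0.
(* For [beta] this is the dual estimate; for [alpha] it serves to show that the integral of [F] is
   finite, so that the rest is real arithmetic. *)
have F_le (m : probability T R) : (\int[m]_x (F x)%:E <=
    (\sum_i fine (m (q @^-1` [set i])) * (M + e - psi i))%:E + \int[m]_x (E x)%:E)%E.
  rewrite -(int_cells m (fun i => M + e - psi i))// -ge0_integralD//; last 3 first.
  - by move=> x _; rewrite lee_fin.
  - exact: (measurable_finite_valued q mq (fun i => M + e - psi i)).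
  - by move=> x _; rewrite lee_fin.
  apply: ge0_le_integral => //.
  - by move=> x _; rewrite lee_fin.
  - by apply: emeasurable_funD => //; exact: (measurable_finite_valued q mq (fun i => M + e - psi i)).
  - by move=> x _; rewrite -EFinD lee_fin FE; exact: le_psi.
have fin (x : \bar R) (r : R) : (0 <= x)%E -> (x <= r%:E)%E -> exists r', x = r'%:E.
  move=> x0 xr; exists (fine x); rewrite fineK// ge0_fin_numE//.
  exact: le_lt_trans xr (ltry _).
have int0 (m : probability T R) (f : T -> R) : (forall x, 0 <= f x) ->
  (0 <= \int[m]_x (f x)%:E)%E by move=> f0; apply: integral_ge0 => x _; rewrite lee_fin.
have [ea eaE] := fin _ _ (int0 alpha E E0) aN.
have [eb ebE] := fin _ _ (int0 beta E E0) bN.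
have := F_le alpha; have := F_le beta; rewrite eaE ebE -!EFinD => Fb Fa.
have [fa faE] := fin _ _ (int0 alpha F F0) Fa.
have [fb fbE] := fin _ _ (int0 beta F F0) Fb.
move: aN bN Fb alpha_le; rewrite eaE ebE faE fbE -!EFinD !lee_fin => aN bN Fb.
have -> : \sum_i a i * (phi i + M) = \sum_i a i * phi i + M.
  under eq_bigr do rewrite mulrDr.
  by rewrite big_split/= -mulr_suml sum_cells mul1r.
have Eb : \sum_i b i * (M + e - psi i) = M + e - \sum_i b i * psi i.
  under eq_bigr do rewrite mulrDr mulrN.
  by rewrite big_split/= -mulr_suml sum_cells mul1r sumrN.
move: Fb; rewrite Eb => Fb Fa'.
apply: le_trans W_le _; rewrite eaE ebE -!EFinD lee_fin.
by move: pcost; lra.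
Qed.
End Duality.

(** * The Wasserstein distance as a countable supremum *)

Section DualGap.
Context {R : realType} {d : measure_display} {T : measurableType d}
  (dist : T -> T -> R) (s : nat -> T).
Hypothesis dist_metric : is_metric dist.
Hypothesis s_dense : forall x (e : R), 0 < e -> exists n, dist x (s n) < e.
Hypothesis dist_borel : borel_of_dist dist.

Let dist_sep : dist_separable dist.
Proof. by exists s. Qed.

Local Open Scope ereal_scope.
Implicit Types alpha beta delta : probability T R.

Let F n x := (cones_enum dist s n x)%:E.
Let F0 n x : 0 <= F n x.
Proof. by rewrite lee_fin cones_enum_ge0. Qed.
Let mF n : measurable_fun setT (F n).
Proof. exact: measurable_EFin_lip1 (lip1_cones_enum dist s dist_metric n). Qed.

Let esups0_ge (u : (\bar R)^nat) n : u n <= esups u 0%N.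
Proof. by apply: ereal_sup_ubound; exists n. Qed.

(** [esups _ 0] is the supremum over all indices. If both integrals are infinite, the convention
    [+oo - +oo = -oo] applies, and [maxe 0] keeps the gap nonnegative. *)
Definition cones_gap alpha beta : \bar R :=
  maxe 0 (esups (fun n => maxe (\int[alpha]_x F n x - \int[beta]_x F n x)
                               (\int[beta]_x F n x - \int[alpha]_x F n x)) 0%N).

Lemma cones_gap_ge0 alpha beta : 0 <= cones_gap alpha beta.
Proof. by rewrite le_max lexx. Qed.

Lemma cones_gapC alpha beta : cones_gap alpha beta = cones_gap beta alpha.
Proof.
by rewrite /cones_gap; congr (maxe 0 (esups _ 0%N)); apply/funext => n; rewrite maxC.
Qed.

Lemma int_le_cones_gap n alpha beta :
  \int[alpha]_x F n x <= \int[beta]_x F n x + cones_gap alpha beta.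
Proof.
have b0 : 0 <= \int[beta]_x F n x by exact: integral_ge0.
have [bfin|] := boolP (\int[beta]_x F n x \is a fin_num); last first.
  rewrite ge0_fin_numE// -leNgt leye_eq => /eqP ->.
  by rewrite addye ?leey// gt_eqF// (lt_le_trans _ (cones_gap_ge0 _ _)).
rewrite -leeBlDl// /cones_gap le_max; apply/orP; right.
apply: le_trans (esups0_ge _ n); by rewrite le_max lexx.
Qed.

(** With [int_le_cones_gap], this characterizes the gap by additive inequalities, free of
    differences of infinities. *)
Lemma cones_gap_le alpha beta C : 0 <= C ->
  (forall n, \int[alpha]_x F n x <= \int[beta]_x F n x + C) ->
  (forall n, \int[beta]_x F n x <= \int[alpha]_x F n x + C) ->
  cones_gap alpha beta <= C.
Proof.
move=> C0 ab ba; rewrite /cones_gap ge_max C0/=; apply: ge_ereal_sup => _ [n _ <-].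
have sub_le (u v : \bar R) : 0 <= v -> u <= v + C -> u - v <= C.
  case: v => [v _|_ _|//]; first by rewrite leeBlDl.
  by rewrite addeNy; exact: le_trans C0.
by rewrite ge_max !sub_le//; exact: integral_ge0.
Qed.

Lemma cones_gap_triangle beta alpha delta :
  cones_gap alpha delta <= cones_gap alpha beta + cones_gap beta delta.
Proof.
apply: cones_gap_le => [|n|n]; first by rewrite adde_ge0 ?cones_gap_ge0.
  apply: le_trans (int_le_cones_gap n alpha beta) _.
  by rewrite (addeC (cones_gap alpha beta)) addeA leeD2r// int_le_cones_gap.
apply: le_trans (int_le_cones_gap n delta beta) _.
by rewrite addeA (cones_gapC beta) leeD2r// (cones_gapC alpha) int_le_cones_gap.
Qed.

Lemma cones_gap_le_Wass alpha beta : cones_gap alpha beta <= Wass dist alpha beta.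
Proof.
have FL n := lip1_cones_enum dist s dist_metric n.
have F0' n := cones_enum_ge0 dist s dist_metric n.
apply: cones_gap_le => [|n|n]; first exact: Wass_ge0.
  exact: integral_lip1_le_fst.
exact: integral_lip1_le_snd.
Qed.

Let M alpha := \int[alpha]_x (dist (s 0) x)%:E.

(** The cone of height 0 at [s 0] is [dist (s 0)], so the first moment is among the integrals
    compared by the gap. *)
Let MF : exists n, forall alpha, M alpha = \int[alpha]_x F n x.
Proof.
exists (pickle ((0%Q, 0%N), [::] : seq (rat * nat))) => alpha.
apply: eq_integral => x _.
by rewrite /F cones_enum_pickle /cones big_nil /cone/= rmorph0 normr0 add0r.
Qed.

(** If [alpha] has infinite first moment, the index from [MF] already makes the gap infinite.
    Otherwise approximate duality applies with [e / 10]. Kernels, whose moments may be infinite at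
    some points, are thereby covered. *)
Lemma Wass_eq_cones_gap alpha beta :
  \int[beta]_x (dist (s 0) x)%:E < +oo -> Wass dist alpha beta = cones_gap alpha beta.
Proof.
move=> bfin; apply/eqP; rewrite eq_le cones_gap_le_Wass andbT.
have [n Mn] := MF.
have [afin|] := boolP (M alpha < +oo); last first.
  rewrite -leNgt leye_eq => /eqP ay.
  have := int_le_cones_gap n alpha beta; rewrite -!Mn ay leye_eq => /eqP.
  move: bfin; rewrite -/(M beta); have : 0 <= M beta.
    by apply: integral_ge0 => x _; rewrite lee_fin dist_ge0.
  case: (M beta) => // r _ _; case: (cones_gap _ _) => //= r'; by rewrite leey.
apply/lee_addgt0Pr => e e0.
have [m] := Wass_le_cones dist s dist_metric s_dense dist_borel alpha beta (e / 10)
  (divr_gt0 e0 (ltr0n _ 10)) afin bfin.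
rewrite mulrC divfK// => /le_trans; apply; rewrite leeD2r//.
rewrite /cones_gap le_max; apply/orP; right.
apply: le_trans (esups0_ge _ m); by rewrite le_max lexx.
Qed.

(** Measurability passes through countable suprema. The space [S] is left general: the gap occurs on
    pairs, with two kernels, and on single points, with one kernel and a fixed measure. *)
Lemma measurable_cones_gap d' (S : measurableType d') (k1 k2 : S -> probability T R) :
  (forall h : T -> \bar R, measurable_fun setT h -> (forall x, 0 <= h x) ->
    measurable_fun setT (fun z => \int[k1 z]_x h x)) ->
  (forall h : T -> \bar R, measurable_fun setT h -> (forall x, 0 <= h x) ->
    measurable_fun setT (fun z => \int[k2 z]_x h x)) ->
  measurable_fun setT (fun z => cones_gap (k1 z) (k2 z)).
Proof.
move=> mk1 mk2; apply: measurable_maxe => //; apply: measurable_fun_esups => n.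
by apply: measurable_maxe; apply: emeasurable_funB; auto.
Qed.

End DualGap.

(** * First moments and the mean distance *)

Section Moments.
Context {R : realType} {d : measure_display} {T : measurableType d}
  (dist : T -> T -> R).
Hypotheses (dist_metric : is_metric dist) (dist_sep : dist_separable dist).
Hypothesis dist_borel : borel_of_dist dist.

Local Open Scope ereal_scope.
Implicit Types alpha beta m : probability T R.

Let dist_ge0 := dist_ge0 dist dist_metric.
Let dis_tri := dis_tri dist dist_metric.
Let dist_sym := dist_sym dist dist_metric.
Let mD := measurable_EFin_dist_pair dist dist_metric dist_sep dist_borel.
Let D0 (z : T * T) : 0 <= (dist z.1 z.2)%:E.
Proof. by rewrite lee_fin. Qed.

Let mdist x : measurable_fun setT (fun y => (dist x y)%:E).
Proof. exact: measurable_EFin_lip1 (lip1_dist dist dist_metric x). Qed.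

Lemma measurable_int_dist alpha :
  measurable_fun setT (fun x => \int[alpha]_y (dist x y)%:E).
Proof. exact: (measurable_fun_fubini_tonelli_F (fun z => (dist z.1 z.2)%:E) mD D0). Qed.

Lemma int_dist_ge0 alpha x : 0 <= \int[alpha]_y (dist x y)%:E.
Proof. by apply: integral_ge0 => y _; rewrite lee_fin. Qed.

Lemma int_distC alpha beta : \int[alpha]_x \int[beta]_y (dist x y)%:E =
  \int[beta]_x \int[alpha]_y (dist x y)%:E.
Proof.
rewrite (fubini_tonelli (fun z => (dist z.1 z.2)%:E) mD D0)/=.
by apply: eq_integral => y _; apply: eq_integral => x _; rewrite dist_sym.
Qed.

Lemma first_moment_finite_at x alpha : first_moment_finite dist alpha ->
  \int[alpha]_y (dist x y)%:E < +oo.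
Proof.
move=> [x0 fin]; apply: (@le_lt_trans _ _ (\int[alpha]_y ((dist x x0)%:E + (dist x0 y)%:E))).
  apply: ge0_le_integral => //.
  - by move=> y _; rewrite lee_fin.
  - by apply: emeasurable_funD => //; exact: mdist.
  - by move=> y _; rewrite -EFinD lee_fin.
rewrite ge0_integralD//; last 2 first.
- by move=> y _; rewrite lee_fin.
- by move=> y _; rewrite lee_fin.
rewrite integral_probability_cst.
by rewrite lte_add_pinfty// ltry.
Qed.

Lemma int_dist_le x alpha beta : \int[alpha]_y \int[beta]_z (dist y z)%:E <=
  \int[alpha]_y (dist x y)%:E + \int[beta]_z (dist x z)%:E.
Proof.
have E y : \int[beta]_z (dist y z)%:E <= (dist x y)%:E + \int[beta]_z (dist x z)%:E.
  have -> : (dist x y)%:E = \int[beta]_z (dist x y)%:E.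
    by rewrite integral_probability_cst.
  rewrite -ge0_integralD//; last 2 first.
  - by move=> z _; rewrite lee_fin.
  - by move=> z _; rewrite lee_fin.
  apply: ge0_le_integral => //.
  - by move=> z _; rewrite lee_fin.
  - by apply: emeasurable_funD => //; exact: mdist.
  - by move=> z _; rewrite -EFinD lee_fin (dist_sym x y).
apply: (@le_trans _ _ (\int[alpha]_y ((dist x y)%:E + \int[beta]_z (dist x z)%:E))).
  apply: ge0_le_integral => //.
  - by move=> y _; exact: int_dist_ge0.
  - exact: measurable_int_dist.
  - by apply: emeasurable_funD => //; exact: mdist.
rewrite ge0_integralD//; last 2 first.
- by move=> y _; rewrite lee_fin.
- by move=> y _; exact: int_dist_ge0.
by rewrite integral_probability_cst.
Qed.

Lemma int_dist_le_Wass m alpha beta : \int[m]_x \int[alpha]_y (dist x y)%:E <=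
  \int[m]_x \int[beta]_y (dist x y)%:E + Wass dist alpha beta.
Proof.
rewrite -[X in _ <= _ + X](integral_probability_cst m) -ge0_integralD//; last 3 first.
- by move=> x _; exact: int_dist_ge0.
- exact: measurable_int_dist.
- by move=> x _; exact: Wass_ge0.
apply: ge0_le_integral => //.
- by move=> x _; exact: int_dist_ge0.
- exact: measurable_int_dist.
- by apply: emeasurable_funD => //; exact: measurable_int_dist.
- by move=> x _; apply: integral_lip1_le_fst => //; exact: lip1_dist.
Qed.

(** The two copies of [alpha] are replaced by [beta] one at a time, each at the cost of one
    Wasserstein distance. *)
Lemma mean_dist_le_Wass alpha beta : mean_dist dist alpha <=
  mean_dist dist beta + (Wass dist alpha beta + Wass dist alpha beta).
Proof.
apply: le_trans (int_dist_le_Wass alpha alpha beta) _.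
by rewrite int_distC addeA leeD2r// int_dist_le_Wass.
Qed.

(** For almost every [a] the integral of [dist a] vanishes; a single such [a] suffices, because then
    almost every point equals [a]. *)
Lemma mean_dist_eq0 alpha : mean_dist dist alpha = 0 -> is_dirac alpha.
Proof.
move=> m0.
have E (f : T -> \bar R) : measurable_fun setT f -> (forall x, 0 <= f x) ->
    \int[alpha]_x f x = 0 -> exists2 N, measurable N /\ alpha N = 0 &
    forall x, ~ N x -> f x = 0.
  move=> mf f0 If; have /(ae_eq_integral_abs _ measurableT mf).1 : 
      \int[alpha]_x `|f x| = 0.
    by rewrite -[RHS]If; apply: eq_integral => x _; rewrite gee0_abs.
  move=> [N [mN N0 fN]]; exists N => // x Nx; apply: contrapT => fx.
  by apply: Nx; apply: fN => /= /(_ I).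
have [N [mN N0] NP] := E _ (measurable_int_dist alpha) (int_dist_ge0 alpha) m0.
have [a aN] : exists a, ~ N a.
  apply: contrapT => /forallNP H; have : alpha setT = 0.
    by rewrite -N0; congr (alpha _); apply/seteqP; split => // x _; exact: contrapT (H x).
  by rewrite probability_setT => /eqP; rewrite onee_eq0.
have [K [mK K0] KP] := E _ (mdist a) (fun x => D0 (a, x)) (NP a aN).
have Ka x : ~ K x -> x = a.
  by move=> /KP[ax]; have [_ h _ _] := dist_metric; rewrite ((h a x).1 ax).
have sub0 A : measurable A -> ~ A a -> alpha A = 0.
  move=> mA Aa; apply/eqP; rewrite -measure_le0 -K0; apply: le_measure; rewrite ?inE//.
  by move=> x Ax; apply: contrapT => /Ka xa; apply: Aa; rewrite -xa.
exists a => A mA; rewrite diracE; have [aA|aA] := pselect (A a).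
  rewrite mem_set//; have := probability_setC alpha (measurableC mA).
  rewrite setCK (sub0 (~` A)) ?sube0//; exact: measurableC.
by rewrite memNset//= sub0.
Qed.

End Moments.

(** * Comparison with the adapted distance *)

Section AdaptedWasserstein.
Context {R : realType} {d : measure_display} {T : measurableType d}
  (dist : T -> T -> R).
Hypotheses (dist_metric : is_metric dist) (dist_sep : dist_separable dist).
Hypothesis dist_borel : borel_of_dist dist.

Local Open Scope ereal_scope.

Let dist_ge0 := dist_ge0 dist dist_metric.
Let mD := measurable_EFin_dist_pair dist dist_metric dist_sep dist_borel.

Lemma AW_ge0 mu mut (k kt : T -> probability T R) : 0 <= AW dist mu mut k kt.
Proof.
apply: le_ereal_inf_tmp => _ [g _ <-]; apply: integral_ge0 => z _.
by rewrite adde_ge0 ?lee_fin// Wass_ge0.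
Qed.

Lemma Wint_ge0 mu nu (k : T -> probability T R) : 0 <= Wint dist mu nu k.
Proof. by apply: integral_ge0 => x _; exact: Wass_ge0. Qed.

(** The product coupling bounds each [Wass (k x) nu], and averaging over [x] turns the kernels into
    [nu]. *)
Lemma Wint_le_mean_dist mu nu pi (k : T -> probability T R) :
  coupling mu nu pi -> disintegration pi mu k ->
  Wint dist mu nu k <= mean_dist dist nu.
Proof.
move=> cpl dis; rewrite /mean_dist (integral_disintegration _ _ _ _ cpl dis); last 2 first.
- exact: (measurable_int_dist dist dist_metric dist_sep dist_borel).
- exact: (int_dist_ge0 dist dist_metric).
apply: le_integral_nonmeasurable => x; first exact: Wass_ge0.
exact: (Wass_le_product dist dist_metric dist_sep dist_borel).
Qed.

(** This serves to make [AW] finite: take product couplings at both levels and pass through the base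
    point [x]. *)
Lemma AW_le_moments x mu mut nu nut pi pit (k kt : T -> probability T R) :
  coupling mu nu pi -> disintegration pi mu k ->
  coupling mut nut pit -> disintegration pit mut kt ->
  AW dist mu mut k kt <=
    \int[mu]_y (dist x y)%:E + \int[mut]_y (dist x y)%:E +
    (\int[nu]_y (dist x y)%:E + \int[nut]_y (dist x y)%:E).
Proof.
move=> cpl dis cplt dis_t; pose g : probability (T * T)%type R := mu \x mut.
have gcpl : coupling mu mut g by exact: coupling_product.
have mdist : measurable_fun setT (fun y => (dist x y)%:E).
  exact: (measurable_EFin_lip1 dist dist_borel _ (lip1_dist dist dist_metric x)).
have dist0 y : 0 <= (dist x y)%:E by rewrite lee_fin.
have mk := measurable_integral_disintegration pi mu k dis _ mdist dist0.
have mkt := measurable_integral_disintegration pit mut kt dis_t _ mdist dist0.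
have int0 (m : probability T R) : 0 <= \int[m]_y (dist x y)%:E by exact: integral_ge0.
have mk1 : measurable_fun setT (fun z : T * T => \int[k z.1]_y (dist x y)%:E).
  exact: (measurableT_comp mk measurable_fst).
have mk2 : measurable_fun setT (fun z : T * T => \int[kt z.2]_y (dist x y)%:E).
  exact: (measurableT_comp mkt measurable_snd).
apply: (@le_trans _ _ (\int[g]_z ((dist z.1 z.2)%:E +
    (\int[k z.1]_y (dist x y)%:E + \int[kt z.2]_y (dist x y)%:E)))).
  apply: (@le_trans _ _ (\int[g]_z ((dist z.1 z.2)%:E + Wass dist (k z.1) (kt z.2)))).
    by apply: ereal_inf_lbound; exists g.
  apply: le_integral_nonmeasurable => z; first by rewrite adde_ge0 ?lee_fin// Wass_ge0.
  rewrite leeD2l//.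
  apply: le_trans (int_dist_le dist dist_metric dist_sep dist_borel x _ _).
  exact: (Wass_le_product dist dist_metric dist_sep dist_borel).
rewrite ge0_integralD//; last 3 first.
- by move=> z _; rewrite lee_fin.
- by move=> z _; rewrite adde_ge0.
- exact: emeasurable_funD.
rewrite leeD//.
  rewrite (fubini_tonelli1 (fun z => (dist z.1 z.2)%:E))//; last by move=> z; rewrite lee_fin.
  exact: (int_dist_le dist dist_metric dist_sep dist_borel x).
rewrite ge0_integralD// (integral_coupling_fst _ _ _ _ gcpl mk)//.
rewrite (integral_coupling_snd _ _ _ _ gcpl mkt)//.
rewrite leeD//.
  by rewrite (integral_disintegration _ _ _ _ cpl dis).
by rewrite (integral_disintegration _ _ _ _ cplt dis_t).
Qed.

Section Comparison.
Variables (mu nu mut nut : probability T R) (pi pit : probability (T * T)%type R).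
Variables (k kt : T -> probability T R).
Hypotheses (cpl : coupling mu nu pi) (cplt : coupling mut nut pit).
Hypotheses (dis : disintegration pi mu k) (dis_t : disintegration pit mut kt).
Hypotheses (Hnu : first_moment_finite dist nu) (Hnut : first_moment_finite dist nut).

Let le_integralD (g : probability (T * T)%type R) (u h v : T * T -> \bar R) :
  measurable_fun setT u -> measurable_fun setT h -> measurable_fun setT v ->
  (forall z, 0 <= u z) -> (forall z, 0 <= h z) -> (forall z, 0 <= v z) ->
  (forall z, u z <= h z + v z) -> \int[g]_z u z <= \int[g]_z h z + \int[g]_z v z.
Proof.
move=> mu_ mh mv u0 h0 v0 uhv; rewrite -ge0_integralD//.
by apply: ge0_le_integral => //; exact: emeasurable_funD.
Qed.

(* [Wass (k x) (kt y)] may fail to be measurable where both kernels have infinite first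
   moment; the measurable [h] replaces it under the integral. *)
Lemma Wass_kernel_minorant : exists h : T * T -> \bar R,
  [/\ measurable_fun setT h /\ (forall z, 0 <= h z),
      forall z, h z <= Wass dist (k z.1) (kt z.2),
      forall z, Wass dist (k z.1) nu <= h z + (Wass dist (kt z.2) nut + Wass dist nu nut),
      forall z, Wass dist (kt z.2) nut <= h z + (Wass dist (k z.1) nu + Wass dist nu nut) &
      (measurable_fun setT (fun x => Wass dist (k x) nu) /\
       measurable_fun setT (fun x => Wass dist (kt x) nut)) /\
      forall g, coupling mu mut g -> Wass dist nu nut <= \int[g]_z h z].
Proof.
have [s s_dense] := dist_sep.
pose gap := cones_gap dist s.
have gap0 a b : 0 <= gap a b by exact: cones_gap_ge0.
have gapT a b c : gap a c <= gap a b + gap b c.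
  exact: (cones_gap_triangle dist s dist_metric).
have gapC a b : gap a b = gap b a by exact: cones_gapC.
(* Finite moments of [nu] and [nut] alone turn the distances to them into gaps, for every first
   argument. *)
have Wnu a : Wass dist a nu = gap a nu.
  apply: (Wass_eq_cones_gap dist s dist_metric s_dense dist_borel).
  exact: (first_moment_finite_at dist dist_metric dist_borel).
have Wnut a : Wass dist a nut = gap a nut.
  apply: (Wass_eq_cones_gap dist s dist_metric s_dense dist_borel).
  exact: (first_moment_finite_at dist dist_metric dist_borel).
have mk := measurable_integral_disintegration pi mu k dis.
have mkt := measurable_integral_disintegration pit mut kt dis_t.
have mk1 (f : T -> \bar R) : measurable_fun setT f -> (forall x, 0 <= f x) ->
    measurable_fun setT (fun z : T * T => \int[k z.1]_x f x).
  by move=> mf f0; exact: (measurableT_comp (mk f mf f0) measurable_fst).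
have mk2 (f : T -> \bar R) : measurable_fun setT f -> (forall x, 0 <= f x) ->
    measurable_fun setT (fun z : T * T => \int[kt z.2]_x f x).
  by move=> mf f0; exact: (measurableT_comp (mkt f mf f0) measurable_snd).
have mgap := measurable_cones_gap dist s dist_metric dist_borel.
have mh : measurable_fun setT (fun z : T * T => gap (k z.1) (kt z.2)) by exact: mgap.
exists (fun z => gap (k z.1) (kt z.2)); split => //.
- by move=> z; exact: (cones_gap_le_Wass dist s dist_metric s_dense dist_borel).
- move=> z; rewrite !Wnu !Wnut; apply: le_trans (gapT _ (kt z.2) _) _.
  rewrite leeD2l//; apply: le_trans (gapT _ nut _) _.
  by rewrite leeD2l// (gapC nut).
- move=> z; rewrite !Wnu !Wnut; apply: le_trans (gapT _ (k z.1) _) _.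
  rewrite (gapC (kt z.2)) leeD2l//; exact: gapT.
split.
  split; first by under eq_fun do rewrite Wnu; apply: mgap => // *; exact: measurable_cst.
  by under eq_fun do rewrite Wnut; apply: mgap => // *; exact: measurable_cst.
move=> g gcpl; rewrite Wnut.
have F0 n x : 0 <= (cones_enum dist s n x)%:E by rewrite lee_fin cones_enum_ge0.
have mF n : measurable_fun setT (fun x => (cones_enum dist s n x)%:E).
  exact: (measurable_EFin_lip1 dist dist_borel _ (lip1_cones_enum dist s dist_metric n)).
have I0 n (a : probability T R) : 0 <= \int[a]_x (cones_enum dist s n x)%:E.
  exact: integral_ge0.
(* Whatever the coupling [g] of the first marginals, [nu] and [nut] are mixtures of the kernels over
   [g]; the gap inequality is then integrated function by function, which is joint convexity. *)
have nuE n : \int[nu]_x (cones_enum dist s n x)%:E =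
    \int[g]_z \int[k z.1]_x (cones_enum dist s n x)%:E.
  rewrite (integral_disintegration _ _ _ _ cpl dis)//.
  by rewrite -(integral_coupling_fst _ _ _ _ gcpl (mk _ (mF n) (F0 n))).
have nutE n : \int[nut]_x (cones_enum dist s n x)%:E =
    \int[g]_z \int[kt z.2]_x (cones_enum dist s n x)%:E.
  rewrite (integral_disintegration _ _ _ _ cplt dis_t)//.
  by rewrite -(integral_coupling_snd _ _ _ _ gcpl (mkt _ (mF n) (F0 n))).
apply: cones_gap_le => [//||n|n]; first by apply: integral_ge0 => z _; exact: gap0.
  rewrite nuE nutE addeC; apply: le_integralD => //.
  - exact: mk1.
  - exact: mk2.
  - by move=> z; rewrite addeC int_le_cones_gap.
rewrite nuE nutE addeC; apply: le_integralD => //.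
- exact: mk2.
- exact: mk1.
- by move=> z; rewrite addeC gapC int_le_cones_gap.
Qed.

(** Additivity of the integral is applied to the measurable [h]; only afterwards is [h] enlarged to
    the full cost, by monotonicity alone. *)
Let integral_le_cost (g : probability (T * T)%type R) (h u v : T * T -> \bar R) c :
  measurable_fun setT h -> measurable_fun setT u -> measurable_fun setT v ->
  (forall z, 0 <= h z) -> (forall z, 0 <= u z) -> (forall z, 0 <= v z) -> 0 <= c ->
  (forall z, h z <= Wass dist (k z.1) (kt z.2)) -> (forall z, u z <= h z + (v z + c)) ->
  \int[g]_z u z <=
    \int[g]_z v z + c + \int[g]_z ((dist z.1 z.2)%:E + Wass dist (k z.1) (kt z.2)).
Proof.
move=> mh mU mV h0 u0 v0 c0 hW uv.
apply: (@le_trans _ _ (\int[g]_z h z + \int[g]_z (v z + c))).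
  exact: (le_integralD g _ _ _ mU mh (emeasurable_funD mV (measurable_cst _))
    u0 h0 (fun z => adde_ge0 (v0 z) c0) uv).
rewrite ge0_integralD// integral_probability_cst addeC leeD2l//.
apply: le_integral_nonmeasurable => // z; apply: le_trans (hW z) _.
by rewrite leeDr// lee_fin.
Qed.

Let cost_ge0 (g : probability (T * T)%type R) :
  0 <= \int[g]_z ((dist z.1 z.2)%:E + Wass dist (k z.1) (kt z.2)).
Proof. by apply: integral_ge0 => z _; rewrite adde_ge0 ?lee_fin// Wass_ge0. Qed.

(** Integrate over a coupling the triangle inequality from [k x] to [nu] through [kt y] and [nut],
    then take the infimum. *)
Lemma Wint_le_AW :
  Wint dist mu nu k <= Wint dist mut nut kt + Wass dist nu nut + AW dist mu mut k kt.
Proof.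
have [h [[mh h0] hW uv _ [[mWk mWkt] _]]] := Wass_kernel_minorant.
apply: le_add_ereal_inf => [|_ [g _ <-]|_ [g gcpl <-]]; last 1 first.
- rewrite /Wint -(integral_coupling_fst _ _ _ _ gcpl mWk); last by move=> x; exact: Wass_ge0.
  rewrite -(integral_coupling_snd _ _ _ _ gcpl mWkt); last by move=> x; exact: Wass_ge0.
  apply: (integral_le_cost g h) => //; try by move=> *; exact: Wass_ge0.
  + exact: (measurableT_comp mWk measurable_fst).
  + exact: (measurableT_comp mWkt measurable_snd).
- by rewrite adde_ge0 ?Wint_ge0 ?Wass_ge0.
- exact: cost_ge0.
Qed.

Lemma Wint_ge_AW :
  Wint dist mut nut kt <= Wint dist mu nu k + Wass dist nu nut + AW dist mu mut k kt.
Proof.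
have [h [[mh h0] hW _ vu [[mWk mWkt] _]]] := Wass_kernel_minorant.
apply: le_add_ereal_inf => [|_ [g _ <-]|_ [g gcpl <-]]; last 1 first.
- rewrite /Wint -(integral_coupling_fst _ _ _ _ gcpl mWk); last by move=> x; exact: Wass_ge0.
  rewrite -(integral_coupling_snd _ _ _ _ gcpl mWkt); last by move=> x; exact: Wass_ge0.
  apply: (integral_le_cost g h) => //; try by move=> *; exact: Wass_ge0.
  + exact: (measurableT_comp mWkt measurable_snd).
  + exact: (measurableT_comp mWk measurable_fst).
- by rewrite adde_ge0 ?Wint_ge0 ?Wass_ge0.
- exact: cost_ge0.
Qed.

(** Joint convexity bounds the left side by the integral of [h], which is below the cost of every
    coupling. *)
Lemma Wass_le_AW : Wass dist nu nut <= AW dist mu mut k kt.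
Proof.
have [h [[mh h0] hW _ _ [_ Wh]]] := Wass_kernel_minorant.
apply: le_ereal_inf_tmp => _ [g gcpl <-]; apply: le_trans (Wh g gcpl) _.
apply: le_integral_nonmeasurable => // z; apply: le_trans (hW z) _.
by rewrite leeDr// lee_fin.
Qed.

End Comparison.
End AdaptedWasserstein.

(** * Stability of the Wasserstein correlation coefficient *)

Theorem mainTheorem8 (R : realType) (d : measure_display) (T : measurableType d)
  (dist : T -> T -> R)
  (Hpolish : polish dist) (Hborel : borel_of_dist dist)
  (mu nu mut nut : probability T R)
  (pi pit : probability (T * T)%type R)
  (k kt : T -> probability T R)
  (Hpi : coupling mu nu pi) (Hpit : coupling mut nut pit)
  (Hk : disintegration pi mu k) (Hkt : disintegration pit mut kt)
  (Hmu : first_moment_finite dist mu) (Hnu : first_moment_finite dist nu)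
  (Hmut : first_moment_finite dist mut) (Hnut : first_moment_finite dist nut) :
  ((`| Wint dist mu nu k - Wint dist mut nut kt |
      <= AW dist mu mut k kt + Wass dist nu nut)%E /\
   (AW dist mu mut k kt + Wass dist nu nut <= 2%:E * AW dist mu mut k kt)%E) /\
  (~ is_dirac nu -> ~ is_dirac nut ->
   let f := fine (mean_dist dist nut) in
   let g := `| fine (mean_dist dist nut) - fine (mean_dist dist nu) | in
   let aw := fine (AW dist mu mut k kt) in
   let w := fine (Wass dist nu nut) in
   `| Wcorr dist mu nu k - Wcorr dist mut nut kt | <= (aw + w + g) / f /\
   (aw + w + g) / f <= (aw + 3 * w) / f /\
   (aw + 3 * w) / f <= 4 * aw / f).
Proof.
have [Hmetric Hsep _] := Hpolish.
have [s _] := Hsep.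
have fin (x : \bar R) (y : \bar R) : (0 <= x)%E -> (x <= y)%E -> (y < +oo)%E ->
    exists2 r : R, 0 <= r & x = r%:E.
  move=> x0 xy yoo; have xoo := le_lt_trans xy yoo.
  by exists (fine x); [exact: fine_ge0|rewrite fineK// ge0_fin_numE].
have mfin (m : probability T R) : first_moment_finite dist m ->
    (\int[m]_y (dist (s 0) y)%:E < +oo)%E.
  exact: first_moment_finite_at.
have mean0 (m : probability T R) : (0 <= mean_dist dist m)%E.
  by apply: integral_ge0 => y _; exact: int_dist_ge0.
(* From here on each quantity is shown finite and replaced by a real number, so that the final
   estimates become real arithmetic. *)
have mean_fin (m : probability T R) : first_moment_finite dist m ->
    exists2 r : R, 0 <= r & mean_dist dist m = r%:E.
  move=> Hm; apply: fin (mean0 m) (int_dist_le dist Hmetric Hsep Hborel (s 0) m m) _.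
  by rewrite lte_add_pinfty// mfin.
have [fnu fnu0 fnuE] := mean_fin nu Hnu.
have [fnut fnut0 fnutE] := mean_fin nut Hnut.
have [a a0 aE] : exists2 r : R, 0 <= r & Wint dist mu nu k = r%:E.
  apply: fin (Wint_ge0 dist Hmetric mu nu k) (Wint_le_mean_dist dist Hmetric Hsep Hborel _ _ _ _ Hpi Hk) _.
  by rewrite fnuE ltry.
have [b b0 bE] : exists2 r : R, 0 <= r & Wint dist mut nut kt = r%:E.
  apply: fin (Wint_ge0 dist Hmetric mut nut kt) (Wint_le_mean_dist dist Hmetric Hsep Hborel _ _ _ _ Hpit Hkt) _.
  by rewrite fnutE ltry.
have [aw aw0 awE] : exists2 r : R, 0 <= r & AW dist mu mut k kt = r%:E.
  apply: fin (AW_ge0 dist Hmetric _ _ _ _)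
    (AW_le_moments dist Hmetric Hsep Hborel (s 0) _ _ _ _ _ _ _ _ Hpi Hk Hpit Hkt) _.
  by apply: lte_add_pinfty; apply: lte_add_pinfty; apply: mfin.
have w_le := Wass_le_AW dist Hmetric Hsep Hborel _ _ _ _ _ _ _ _ Hpi Hpit Hk Hkt Hnu Hnut.
have [w w0 wE] : exists2 r : R, 0 <= r & Wass dist nu nut = r%:E.
  by apply: fin (Wass_ge0 dist Hmetric nu nut) w_le _; rewrite awE ltry.
have ab := Wint_le_AW dist Hmetric Hsep Hborel _ _ _ _ _ _ _ _ Hpi Hpit Hk Hkt Hnu Hnut.
have ba := Wint_ge_AW dist Hmetric Hsep Hborel _ _ _ _ _ _ _ _ Hpi Hpit Hk Hkt Hnu Hnut.
have a_le := Wint_le_mean_dist dist Hmetric Hsep Hborel _ _ _ _ Hpi Hk.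
have g1 := mean_dist_le_Wass dist Hmetric Hsep Hborel nu nut.
have g2 := mean_dist_le_Wass dist Hmetric Hsep Hborel nut nu.
have := mean_dist_eq0 dist Hmetric Hsep Hborel nut.
rewrite (Wass_sym dist Hmetric Hsep Hborel nut nu) in g2.
move: w_le ab ba a_le g1 g2; rewrite /Wcorr aE bE awE wE fnuE fnutE /=.
rewrite -!EFinD !lee_fin => w_le ab ba a_le g1 g2 dirac; split.
split; last by lra.
  by rewrite ler_norml; apply/andP; split; lra.
move=> _ nutD.
have f0 : 0 < fnut.
  rewrite lt_neqAle fnut0 andbT; apply/eqP => f0; apply: nutD; apply: dirac.
  by rewrite -f0.
(* The constant 3 is one [w] plus these two; the constant 4 then comes from [w <= aw]. *)
have g_le : `|fnut - fnu| <= 2 * w.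
  by rewrite ler_norml; apply/andP; split; lra.
split; last first.
  by split; rewrite ler_pM2r ?invr_gt0//; lra.
rewrite ler_pdivlMr// -[X in _ * X](ger0_norm fnut0) -normrM mulrBl divfK ?gt_eqF//.
(* If [fnu = 0], then [0 <= a <= fnu] gives [a = 0], the first coefficient is 0, and the bound on
   [a - b] suffices. *)
have [m0|m0] := eqVneq fnu 0.
  have -> : a = 0 by lra.
  have : `|b| <= aw + w by rewrite ler_norml; apply/andP; split; lra.
  by rewrite !mul0r sub0r normrN; have := normr_ge0 (fnut - fnu); lra.
have m_gt0 : 0 < fnu by rewrite lt_neqAle eq_sym m0.
(* The change of normalization is separated from the change of numerator; the factor [a / fnu] lies
   between 0 and 1. *)
have -> : a / fnu * fnut - b = (a / fnu) * (fnut - fnu) + (a - b).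
  by field.
have r1 : a / fnu <= 1 by rewrite ler_pdivrMr// mul1r.
have r0 : 0 <= a / fnu by rewrite divr_ge0.
have abn : `|a - b| <= aw + w by rewrite ler_norml; apply/andP; split; lra.
apply: le_trans (ler_normD _ _) _; rewrite normrM (ger0_norm r0).
have : a / fnu * `|fnut - fnu| <= `|fnut - fnu| by rewrite ler_piMl.
by lra.
Qed.
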